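(* Let $d\in\{2,3\}$, $\Omega=(-\pi,\pi)^d$, $\delta\in(0,1)$, and let the kernels $\omega_\delta,\tilde\omega_\delta,\hat\omega_\delta$ satisfy the kernel assumption (K) stated in the context, with constants $0<m<M$. Let $\mathbf f$ (vector valued) and $g$ (scalar) be $\Omega$-periodic with zero mean. Let $(\mathbf u_\delta,p_\delta)$ be the $\Omega$-periodic, zero-mean solution of the nonlocal system $$-\mathcal L_\delta \mathbf u_\delta+\mathcal G_\delta p_\delta=\mathbf f,\qquad \mathcal D_\delta\mathbf u_\delta-\delta^2\mathcal R_\delta p_\delta=g\qquad\text{in }\Omega,$$ and let $(\mathbf u,p)$ be the $\Omega$-periodic, zero-mean solution of the generalized Stokes system $$-\Delta\mathbf u+\nabla p=\mathbf f,\qquad \nabla\cdot\mathbf u=g\qquad\text{in }\Omega.$$ (i) There is a constant $C$ depending only on $m,M$ (independent of $\delta,\omega,\hat\omega,\mathbf f,g$) such that for all $\eta\in[0,1]$ and $\beta\in[0,2]$, $$\|\mathbf u-\mathbf u_\delta\|_{[L^2(\Omega)]^d}\le C\bigl(\delta^2\|\mathbf f\|_{[L^2(\Omega)]^d}+\delta^{\min\{2,1+\beta\}}\|g\|_{H^\beta(\Omega)}\bigr),$$ $$\|p-p_\delta\|_{L^2(\Omega)}\le C\bigl(\delta^{1+\eta}\|\mathbf f\|_{[H^\eta(\Omega)]^d}+\delta^{\beta}\|g\|_{H^\beta(\Omega)}\bigr).$$ (ii) If in addition there are $\alpha\in(0,1)$ and constants $C_1,C_2>0$ with $$\frac{C_1}{r^{d+2\alpha}}\le\omega(r)\le\frac{C_2}{r^{d+2\alpha}}\qquad\text{for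 all } r\in(0,1),$$ then there is a constant $C$ depending only on $m,M$ and $C_1$ such that for all $\eta\in[0,1]$ and $\beta\in[0,2]$, $$\|\mathbf u-\mathbf u_\delta\|_{[H^\alpha(\Omega)]^d}\le C\bigl(\delta^{\min\{2,\,2-2\alpha+\eta\}}\|\mathbf f\|_{[H^{\eta-\alpha}(\Omega)]^d}+\delta^{\min\{2,\,1-\alpha+\beta\}}\|g\|_{H^\beta(\Omega)}\bigr),$$ $$\|p-p_\delta\|_{L^2(\Omega)}\le C\bigl(\delta^{1-\alpha+\eta}\|\mathbf f\|_{[H^{\eta-\alpha}(\Omega)]^d}+\delta^{\beta}\|g\|_{H^\beta(\Omega)}\bigr).$$ (Each estimate is asserted for data for which the norms on its right-hand side are finite.)
   Context: All functions are periodic with period cell $\Omega=(-\pi,\pi)^d$, $d=2$ or $3$, and have zero mean over $\Omega$. Fourier coefficients: $\hat v(\boldsymbol\xi)=\int_\Omega v(\mathbf x)e^{-i\boldsymbol\xi\cdot\mathbf x}\,d\mathbf x$, $\boldsymbol\xi\in\mathbb Z^d$, so that $v(\mathbf x)=(2\pi)^{-d}\sum_{\boldsymbol\xi\ne0}\hat v(\boldsymbol\xi)e^{i\boldsymbol\xi\cdot\mathbf x}$. $H^s(\Omega)$ ($s\in\mathbb R$) is the periodic Sobolev space, measured through Fourier coefficients (weight $|\boldsymbol\xi|^{2s}$ on $|\hat v(\boldsymbol\xi)|^2$, up to a normalizing constant). Kernel assumption (K): $\omega_\delta(|\mathbf x|),\tilde\omega_\delta(|\mathbf x|),\hat\omega_\delta(|\mathbf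 x|)$ are non-negative, radially symmetric, supported in the ball $B(0,\delta)$, and are rescalings $$\omega_\delta(|\mathbf x|)=\frac1{\delta^{d+2}}\omega\Bigl(\frac{|\mathbf x|}{\delta}\Bigr),\quad \tilde\omega_\delta(|\mathbf x|)=\frac1{\delta^{d+2}}\tilde\omega\Bigl(\frac{|\mathbf x|}{\delta}\Bigr),\quad \hat\omega_\delta(|\mathbf x|)=\frac1{\delta^{d+1}}\hat\omega\Bigl(\frac{|\mathbf x|}{\delta}\Bigr)$$ of kernels $\omega,\tilde\omega,\hat\omega$ supported in the unit ball, with $$\frac12\int_{\mathbb R^d}\omega_\delta(|\mathbf x|)|\mathbf x|^2d\mathbf x=\int_{\mathbb R^d}\hat\omega_\delta(|\mathbf x|)|\mathbf x|\,d\mathbf x=d,\qquad m\le\int_{\mathbb R^d}\tilde\omega_\delta(|\mathbf x|)|\mathbf x|^2d\mathbf x\le M$$ for constants $0<m<M$. (The hat in $\hat\omega$ is part of the kernel's name, not a Fourier transform.) Nonlocal operators, with vector kernel $\boldsymbol\omega_\delta(\mathbf x)=\hat\omega_\delta(|\mathbf x|)\,\mathbf x/|\mathbf x|$: $$\mathcal L_\delta\mathbf u(\mathbf x)=\int_{\mathbb R^d}\omega_\delta(|\mathbf y-\mathbf x|)(\mathbf u(\mathbf y)-\mathbf u(\mathbf x))d\mathbf y,\qquad \mathcal G_\delta p(\mathbf x)=\int_{\mathbb R^d}\boldsymbol\omega_\delta(\mathbf y-\mathbf x)(p(\mathbf y)-p(\mathbf x))d\mathbf y,$$ $$\mathcal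 D_\delta\mathbf u(\mathbf x)=\int_{\mathbb R^d}\boldsymbol\omega_\delta(\mathbf y-\mathbf x)\cdot(\mathbf u(\mathbf y)-\mathbf u(\mathbf x))d\mathbf y,\qquad \mathcal R_\delta p(\mathbf x)=\int_{\mathbb R^d}\tilde\omega_\delta(|\mathbf y-\mathbf x|)(p(\mathbf y)-p(\mathbf x))d\mathbf y.$$ On periodic functions they act as Fourier multipliers (which is how they are understood in general): $\widehat{\mathcal L_\delta\mathbf u}=-\lambda_\delta\hat{\mathbf u}$, $\widehat{\mathcal G_\delta p}=i\mathbf b_\delta\hat p$, $\widehat{\mathcal D_\delta\mathbf u}=i\mathbf b_\delta^T\hat{\mathbf u}$, $\widehat{\mathcal R_\delta p}=-c_\delta\hat p$, where $$\lambda_\delta(\boldsymbol\xi)=\int_{|\mathbf s|\le\delta}\omega_\delta(|\mathbf s|)(1-\cos(\boldsymbol\xi\cdot\mathbf s))d\mathbf s,\quad \mathbf b_\delta(\boldsymbol\xi)=\int_{|\mathbf s|\le\delta}\hat\omega_\delta(|\mathbf s|)\frac{\mathbf s}{|\mathbf s|}\sin(\boldsymbol\xi\cdot\mathbf s)d\mathbf s,\quad c_\delta(\boldsymbol\xi)=\int_{|\mathbf s|\le\delta}\tilde\omega_\delta(|\mathbf s|)(1-\cos(\boldsymbol\xi\cdot\mathbf s))d\mathbf s.$$ The solution of the nonlocal system is the one whose Fourier coefficients satisfy, for every $\boldsymbol\xi\in\mathbb Z^d\setminus\{0\}$, $$\begin{pmatrix}\lambda_\delta(\boldsymbol\xi)I_d&i\mathbf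 b_\delta(\boldsymbol\xi)\\ i\mathbf b_\delta(\boldsymbol\xi)^T&\delta^2c_\delta(\boldsymbol\xi)\end{pmatrix}\begin{pmatrix}\hat{\mathbf u}_\delta(\boldsymbol\xi)\\ \hat p_\delta(\boldsymbol\xi)\end{pmatrix}=\begin{pmatrix}\hat{\mathbf f}(\boldsymbol\xi)\\ \hat g(\boldsymbol\xi)\end{pmatrix}$$ (this matrix is invertible for $\boldsymbol\xi\neq0$); the solution of the local system is likewise understood through Fourier coefficients. *)

(* Defs.v *)
From HB Require Import structures.
From mathcomp Require Import all_boot all_order all_algebra.
From mathcomp Require Import complex.
From mathcomp Require Import all_classical all_reals all_analysis.

Set Implicit Arguments.
Unset Strict Implicit.
Unset Printing Implicit Defensive.

Import Order.TTheory GRing.Theory Num.Theory.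
Import numFieldNormedType.Exports.

Local Open Scope classical_set_scope.
Local Open Scope ring_scope.

(* Lebesgue measure on R^n, built from the product of measures: it is the      *)
(* image of lebesgue_measure \x lebesgueRn R n.-1 under (x, t) |-> x :: t.     *)
Section lebesgue_cons.
Context (R : realType) (n : nat).
Variable m : {sigma_finite_measure set (n.-tuple R) -> \bar R}.

Definition consRn (z : measurableTypeR R * n.-tuple R) : n.+1.-tuple R :=
  [the n.+1.-tuple R of z.1 :: z.2].

Lemma measurable_consRn : measurable_fun setT consRn.
Proof. exact: measurable_cons. Qed.

Definition lebesgue_cons : set (n.+1.-tuple R) -> \bar R :=
  pushforward ((@lebesgue_measure R) \x m)%E consRn.

Let lebesgue_cons0 : lebesgue_cons set0 = 0%E.
Proof. by rewrite /lebesgue_cons /pushforward preimage_set0 measure0. Qed.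

Let lebesgue_cons_ge0 A : (0 <= lebesgue_cons A)%E.
Proof. by rewrite /lebesgue_cons /pushforward; exact: measure_ge0. Qed.

Let lebesgue_cons_sigma_additive : semi_sigma_additive lebesgue_cons.
Proof.
move=> F mF tF mUF; rewrite /lebesgue_cons /pushforward preimage_bigcup.
apply: measure_semi_sigma_additive.
- by move=> k; rewrite -[X in measurable X]setTI; exact: measurable_consRn.
- apply/trivIsetP => /= i j _ _ ij; rewrite -preimage_setI.
  by move/trivIsetP : tF => /(_ _ _ _ _ ij) ->//; rewrite preimage_set0.
- by rewrite -preimage_bigcup -[X in measurable X]setTI; exact: measurable_consRn.
Qed.

HB.instance Definition _ := isMeasure.Build _ _ _ lebesgue_cons
  lebesgue_cons0 lebesgue_cons_ge0 lebesgue_cons_sigma_additive.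

Let lebesgue_cons_sigma_finite : sigma_finite setT lebesgue_cons.
Proof.
have /sigma_finiteP[A [AT ndA Aoo]] := sigma_finiteT (@lebesgue_measure R).
have /sigma_finiteP[B [BT ndB Boo]] := sigma_finiteT m.
pose un (t : n.+1.-tuple R) : measurableTypeR R * n.-tuple R :=
  (thead t, [tuple of behead t]).
have unK z : un (consRn z) = z.
  case: z => x t; rewrite /un /consRn /thead tnth0; congr pair.
  exact: val_inj.
have mun : measurable_fun setT un.
  apply/measurable_fun_pairP; split.
    exact: measurable_tnth.
  exact: measurable_behead.
exists (fun k => un @^-1` (A k `*` B k)).
  apply/seteqP; split=> // t _.
  have [i _ Ai] : (\bigcup_i A i) (un t).1 by rewrite -AT.
  have [j _ Bj] : (\bigcup_i B i) (un t).2 by rewrite -BT.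
  exists (maxn i j) => //; split.
    by move: Ai; exact/subsetPset/ndA/leq_maxl.
  by move: Bj; exact/subsetPset/ndB/leq_maxr.
move=> k; have [mA Alt] := Aoo k; have [mB Blt] := Boo k; split.
  by rewrite -[X in measurable X]setTI; apply: mun => //; exact: measurableX.
rewrite /lebesgue_cons /pushforward (_ : _ @^-1` _ = A k `*` B k).
  by rewrite product_measure1E// lte_mul_pinfty// ge0_fin_numE.
by rewrite -comp_preimage (_ : un \o _ = id) ?preimage_id//; exact/funext.
Qed.

HB.instance Definition _ := Measure_isSigmaFinite.Build _ _ _ lebesgue_cons
  lebesgue_cons_sigma_finite.

End lebesgue_cons.

Fixpoint lebesgueRn (R : realType) (n : nat) :
    {sigma_finite_measure set (n.-tuple R) -> \bar R} :=
  match n with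
  | 0 => \d_([tuple] : 0.-tuple R)
  | k.+1 => lebesgue_cons (lebesgueRn R k)
  end.

Section euclidean.
Context (R : realType) (d : nat).

(* The library norm on 'rV[R]_d is the sup norm. *)
Definition dotp (x y : 'rV[R]_d) : R := \sum_(i < d) x 0 i * y 0 i.
Definition enorm (x : 'rV[R]_d) : R := Num.sqrt (dotp x x).

Definition row_of_tuple (t : d.-tuple R) : 'rV[R]_d := \row_i tnth t i.
Definition freq (xi : 'rV[int]_d) : 'rV[R]_d := map_mx intr xi.

End euclidean.

Section distributions.
Context (R : realType) (d : nat).

Definition partials (s : seq 'I_d) (phi : 'rV[R]_d -> R) : 'rV[R]_d -> R :=
  foldr (fun i psi => 'D_(delta_mx 0 i) psi) phi s.

Definition smooth (phi : 'rV[R]_d -> R) : Prop :=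
  forall s, continuous (partials s phi) /\
    forall i x, derivable (partials s phi) x (delta_mx 0 i).

Definition periodic_test (phi : 'rV[R]_d -> R) : Prop :=
  smooth phi /\
  forall i x, phi (x + (2 * pi) *: delta_mx 0 i) = phi x.

Definition functional := ('rV[R]_d -> R) -> R[i].

(* Complex-valued periodic distributions, determined by their values on real   *)
(* test functions: R-linear, and of finite order. A function v integrable over *)
(* the cell Omega is identified with phi |-> int_Omega v phi.                  *)
Definition periodic_distr (v : functional) : Prop :=
  (forall (a : R) phi psi, periodic_test phi -> periodic_test psi ->
     v (fun x => a * phi x + psi x) = (a%:C)%C * v phi + v psi) /\
  (exists (N : nat) (K : R), forall phi B, periodic_test phi ->
     (forall s x, (size s <= N)%N -> `|partials s phi x| <= B) ->
     Normc.normc (v phi) <= K * B).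

Definition zero_mean (v : functional) : Prop := v (cst 1) = 0.

(* v paired with exp(- i xi . x) *)
Definition fourier (v : functional) (xi : 'rV[int]_d) : R[i] :=
  v (fun x => cos (dotp (freq R xi) x)) -
  'i%C * v (fun x => sin (dotp (freq R xi) x)).

Definition fourierv (v : 'I_d -> functional) (xi : 'rV[int]_d) : 'cV[R[i]]_d :=
  \col_i fourier (v i) xi.

(* With the factor (2 pi)^-d, the H^0 norm is exactly the L^2(Omega) norm, by  *)
(* Parseval. Norms take the value +oo outside the space.                       *)
Definition Hnorm_sq (s : R) (v : functional) : \bar R :=
  (((2 * pi) ^- d)%:E *
   \esum_(xi in [set xi : 'rV[int]_d | xi != 0%R])
      (enorm (freq R xi) `^ (2 * s) * Normc.normc (fourier v xi) ^+ 2)%:E)%E.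

Definition Hnorm (s : R) (v : functional) : \bar R :=
  (Hnorm_sq s v `^ 2^-1)%E.

Definition Hnormv (s : R) (v : 'I_d -> functional) : \bar R :=
  ((\sum_(i < d) Hnorm_sq s (v i)) `^ 2^-1)%E.

Definition L2norm (v : functional) : \bar R := Hnorm 0 v.
Definition L2normv (v : 'I_d -> functional) : \bar R := Hnormv 0 v.

End distributions.

Section kernels.
Context (R : realType) (d : nat).

Local Notation mu := (lebesgueRn R d).

(* Radial functions on R^d are given by their profile, a function of r >= 0.   *)
Definition rescale (k : nat) (delta : R) (w : R -> R) (r : R) : R :=
  (delta ^+ k)^-1 * w (r / delta).

Definition unit_kernel (w : R -> R) : Prop :=
  [/\ measurable_fun (`[0, +oo[%classic : set R) w,
      forall r, 0 <= r -> 0 <= w r &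
      forall r, 1 < r -> w r = 0].

Definition moment (k : nat) (w : R -> R) : \bar R :=
  (\int[mu]_t (let x := row_of_tuple t in w (enorm x) * enorm x ^+ k)%:E)%E.

Definition kernel_assumption (m M delta : R) (om omt omh : R -> R) : Prop :=
  [/\ [/\ unit_kernel om, unit_kernel omt & unit_kernel omh],
      ((2^-1)%:E * moment 2 (rescale (d + 2) delta om) = d%:R%:E)%E,
      moment 1 (rescale (d + 1) delta omh) = d%:R%:E &
      (m%:E <= moment 2 (rescale (d + 2) delta omt) <= M%:E)%E].

Definition ballR (delta : R) : set (d.-tuple R) :=
  [set t | enorm (row_of_tuple t) <= delta].

(* lambda_delta for w = omega_delta, c_delta for w = tilde omega_delta *)
Definition diffusion_symbol (delta : R) (w : R -> R) (xi : 'rV[int]_d) : R :=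
  \int[mu]_(t in ballR delta)
    (let s := row_of_tuple t in
     w (enorm s) * (1 - cos (dotp (freq R xi) s))).

Definition gradient_symbol (delta : R) (w : R -> R) (xi : 'rV[int]_d)
    : 'cV[R]_d :=
  \col_i \int[mu]_(t in ballR delta)
    (let s := row_of_tuple t in
     w (enorm s) * (s 0 i / enorm s) * sin (dotp (freq R xi) s)).

Definition saddle_mx (a : R) (b : 'cV[R]_d) (c : R) : 'M[R[i]]_(d + 1) :=
  block_mx (a%:C)%C%:M ('i%C *: map_mx (real_complex R) b)
           ('i%C *: (map_mx (real_complex R) b)^T) (c%:C)%C%:M.

Definition nonlocal_solution (delta : R) (om omt omh : R -> R)
    (f : 'I_d -> functional R d) (g : functional R d)
    (u : 'I_d -> functional R d) (p : functional R d) : Prop :=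
  forall xi : 'rV[int]_d, xi != 0 ->
    saddle_mx (diffusion_symbol delta (rescale (d + 2) delta om) xi)
              (gradient_symbol delta (rescale (d + 1) delta omh) xi)
              (delta ^+ 2 *
               diffusion_symbol delta (rescale (d + 2) delta omt) xi)
      *m col_mx (fourierv u xi) (fourier p xi)%:M
    = col_mx (fourierv f xi) (fourier g xi)%:M.

(* - Laplacian, gradient, divergence have symbols |xi|^2, i xi, i xi^T. *)
Definition stokes_solution
    (f : 'I_d -> functional R d) (g : functional R d)
    (u : 'I_d -> functional R d) (p : functional R d) : Prop :=
  forall xi : 'rV[int]_d, xi != 0 ->
    saddle_mx (enorm (freq R xi) ^+ 2) (freq R xi)^T 0
      *m col_mx (fourierv u xi) (fourier p xi)%:M
    = col_mx (fourierv f xi) (fourier g xi)%:M.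

Record stokes_setting (m M delta : R) (om omt omh : R -> R)
    (f : 'I_d -> functional R d) (g : functional R d)
    (ud : 'I_d -> functional R d) (pd : functional R d)
    (u : 'I_d -> functional R d) (p : functional R d) : Prop := {
  setting_dim : d = 2 \/ d = 3;
  setting_delta : 0 < delta < 1;
  setting_kernels : kernel_assumption m M delta om omt omh;
  setting_f : forall i, periodic_distr (f i) /\ zero_mean (f i);
  setting_g : periodic_distr g /\ zero_mean g;
  setting_ud : forall i, periodic_distr (ud i) /\ zero_mean (ud i);
  setting_pd : periodic_distr pd /\ zero_mean pd;
  setting_nonlocal : nonlocal_solution delta om omt omh f g ud pd;
  setting_u : forall i, periodic_distr (u i) /\ zero_mean (u i);
  setting_p : periodic_distr p /\ zero_mean p;
  setting_stokes : stokes_solution f g u p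
}.

End kernels.

(* Main.v *)
Require Import Defs.
From mathcomp Require Import all_boot all_order all_algebra.
From mathcomp Require Import complex.
From mathcomp Require Import ring lra.
From mathcomp Require Import all_classical all_reals all_analysis.
From mathcomp Require Import measurable_realfun.

Import Order.TTheory GRing.Theory Num.Theory.
Import numFieldNormedType.Exports.

Local Open Scope classical_set_scope.
Local Open Scope ring_scope.

Set Implicit Arguments.
Unset Strict Implicit.
Unset Printing Implicit Defensive.

(** Both systems are diagonal in frequency. At a frequency xi <> 0 put
    k = |xi|, e = xi / k and x = delta k. The kernels are radial, so the
    vector b_delta(xi) is beta e for a real number beta, and each system is a
    saddle-point system with first block a I, off-diagonal i beta e and last
    entry c; solving it and subtracting the two solutions gives, with
    D = lambda delta^2 c + beta^2 and f_e the component of f along e,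
<<
    u - u_delta = (1/k^2 - 1/lambda) (f - f_e e)
                  - ((delta^2 c / D) f_e + i (1/k - beta/D) g) e,
    p - p_delta = (1 - lambda/D) g - i (1/k - beta/D) f_e.
>>
    It remains to bound the four real factors (symbol_error_low and
    symbol_error_high) and to sum over the frequencies.

    Low frequencies, x <= 1. Taylor's formula for sine and cosine and the
    moment normalizations give lambda = k^2 (1 + O(x^2)),
    beta = k (1 + O(x^2)) and 0 <= c <= M k^2, so D is comparable to k^2 and
    the factors are O(delta^2), O(delta^2), O(delta^2 k) and O(x^2). The second
    moments are isotropic because Lebesgue measure is rotation invariant.

    High frequencies, x >= 1. Here beta has no lower bound (it may vanish), but
    D >= lambda delta^2 c and |beta/D| <= D^(-1/2), so all factors are
    controlled as soon as lambda and c are bounded below. The bound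
    lambda >= const delta^-2, uniform over all kernels with the given second
    moment, comes without any computation of spherical averages: since
    1 - cos (s + t) <= 2 (1 - cos s) + 2 (1 - cos t), and since every vector
    of length at most 2k is a sum of two vectors of length k, a radial symbol
    satisfies lambda(xi') <= 4 lambda(xi) whenever |xi'| <= 2 |xi|
    (cos_symbol_le4). Comparing xi with a frequency of length 1/delta, where
    the Taylor bound still works, gives cos_symbol_ge_high. The same argument
    bounds c. Under the lower bound on omega in (ii), integrating only over a
    box of side comparable to 1/k gives the stronger
    lambda >= const delta^-2 x^(2 alpha).

    The two parts of the theorem are then one statement (nonlocal_stokes_error)
    under the hypothesis lambda >= K delta^-2 x^(2 alpha) for x >= 1: part (i)
    is alpha = 0, where K = 2/9 is universal, and part (ii) has K proportional
    to C_1. The exponents of the theorem come out of comparing powers of delta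
    and k in the two regimes. *)

(** * Taylor bounds for sine and cosine *)

Section trig_taylor.
Context {R : realType}.
Implicit Types x t : R.

(** Each Taylor bound below follows from the previous one by integration, in the
    form of the mean value theorem. *)
Lemma le_at0_of_is_derive (f df : R -> R) :
  (forall x, is_derive x 1 f (df x)) -> (forall x, 0 <= x -> 0 <= df x) ->
  forall x, 0 <= x -> f 0 <= f x.
Proof.
move=> fd df0 x; rewrite le_eqVlt => /predU1P[<-//|x0].
have fc : {within `[0, x], continuous f}.
  apply/continuous_subspaceT => y.
  by apply/differentiable_continuous/derivable1_diffP; apply: ex_derive.
have [c] := MVT x0 (fun y _ => fd y) fc.
rewrite in_itv /= => /andP[c0 _] /eqP; rewrite subr_eq => /eqP ->.
by rewrite lerDr subr0 mulr_ge0 ?(ltW x0)// df0// ltW.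
Qed.

Lemma sin_le_id x : 0 <= x -> sin x <= x.
Proof.
move=> x0; rewrite -subr_ge0.
have D (y : R) : is_derive y (1 : R) (fun x : R => x - sin x) (1 - cos y).
  by apply: is_derive_eq.
have := le_at0_of_is_derive D _ x0; rewrite sin0 subr0; apply => y _.
by rewrite subr_ge0 cos_le1.
Qed.

Lemma one_sub_cos_le t : 1 - cos t <= t ^+ 2 / 2.
Proof.
wlog x0 : t / 0 <= t => [H|].
  have [/H//|/ltW] := leP 0 t; rewrite -oppr_ge0 => /H.
  by rewrite cosN sqrrN.
rewrite -subr_ge0.
have D (y : R) : is_derive y (1 : R) (fun x : R => x ^+ 2 / 2 - (1 - cos x)) (y - sin y).
  by apply: is_derive_eq; rewrite !scaler0 /GRing.scale/=; lra.
have := le_at0_of_is_derive D _ x0.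
rewrite cos0 expr0n/= mul0r !subrr; apply => y y0.
by rewrite subr_ge0 sin_le_id.
Qed.

Lemma sin_ge_cubic x : 0 <= x -> x - x ^+ 3 / 6 <= sin x.
Proof.
move=> x0; rewrite -subr_ge0.
have D (y : R) : is_derive y (1 : R) (fun x : R => sin x - (x - x ^+ 3 / 6))
    (y ^+ 2 / 2 - (1 - cos y)).
  by apply: is_derive_eq; rewrite !scaler0 /GRing.scale/=; lra.
have := le_at0_of_is_derive D _ x0.
rewrite sin0 expr0n/= mul0r !subrr; apply => y _.
by rewrite subr_ge0 one_sub_cos_le.
Qed.

Lemma one_sub_cos_ge t : t ^+ 2 / 2 - t ^+ 4 / 24 <= 1 - cos t.
Proof.
wlog x0 : t / 0 <= t => [H|].
  have [/H//|/ltW] := leP 0 t; rewrite -oppr_ge0 => /H.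
  by rewrite cosN !(exprM _ 2 2) sqrrN.
rewrite -subr_ge0.
have D (y : R) : is_derive y (1 : R) (fun x : R => (1 - cos x) - (x ^+ 2 / 2 - x ^+ 4 / 24))
    (sin y - (y - y ^+ 3 / 6)).
  by apply: is_derive_eq; rewrite !scaler0 /GRing.scale/=; lra.
have := le_at0_of_is_derive D _ x0.
rewrite cos0 !expr0n/= !mul0r !subrr; apply => y y0.
by rewrite subr_ge0 sin_ge_cubic.
Qed.
End trig_taylor.

(** * Fubini and one-dimensional invariance of Lebesgue measure *)

Section lebesgueRn_theory.
Context {R : realType}.
Local Notation leb := (@lebesgue_measure R).
Local Open Scope ereal_scope.

Lemma measurable_comp_consRn n (F : n.+1.-tuple R -> \bar R) :
  measurable_fun setT F -> measurable_fun setT (F \o @consRn R n).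
Proof. by move=> mF; apply: measurableT_comp => //; exact: measurable_consRn. Qed.

(** The measure in dimension n.+1 is built as a product, so that Tonelli's
    theorem reduces invariance statements to lower dimension. *)
Lemma integral_lebesgueRnS n (F : n.+1.-tuple R -> \bar R) :
  measurable_fun setT F -> (forall t, 0 <= F t) ->
  \int[lebesgueRn R n.+1]_t F t =
  \int[leb]_x \int[lebesgueRn R n]_t F (consRn (x, t)).
Proof.
move=> mF F0.
rewrite -(fubini_tonelli1 _ (measurable_comp_consRn mF) (fun z => F0 _)).
exact: (ge0_integral_pushforward (@measurable_consRn R n) _ measurableT mF
  (fun y _ => F0 y)).
Qed.

Lemma integral_lebesgueRnS_swap n (F : n.+1.-tuple R -> \bar R) :
  measurable_fun setT F -> (forall t, 0 <= F t) ->
  \int[lebesgueRn R n.+1]_t F t =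
  \int[lebesgueRn R n]_t \int[leb]_x F (consRn (x, t)).
Proof.
move=> mF F0; rewrite integral_lebesgueRnS//.
exact: (fubini_tonelli _ (measurable_comp_consRn mF) (fun z => F0 _)).
Qed.

Lemma ge0_integral_preserved (phi : measurableTypeR R -> measurableTypeR R)
    (F : measurableTypeR R -> \bar R) :
  measurable_fun setT phi ->
  (forall A, measurable A -> leb A = leb (phi @^-1` A)) ->
  measurable_fun setT F -> (forall x, 0 <= F x) ->
  \int[leb]_x F (phi x) = \int[leb]_x F x.
Proof.
move=> mphi phiE mF F0.
transitivity (\int[pushforward leb phi]_x F x).
  exact/esym/(ge0_integral_pushforward mphi leb measurableT mF (fun y _ => F0 y)).
by apply: eq_measure_integral => //= A mA _; rewrite [RHS]phiE.
Qed.

Lemma integral_lebesgue_shift (c : R) (F : R -> \bar R) :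
  measurable_fun setT F -> (forall x, 0 <= F x) ->
  \int[leb]_x F (x + c)%R = \int[leb]_x F x.
Proof.
move=> mF F0; pose phi (x : measurableTypeR R) : measurableTypeR R := (x + c)%R.
have mphi : measurable_fun setT phi by exact: measurable_funD.
apply: (ge0_integral_preserved (phi := phi)) => //.
move=> A mA; apply: (@lebesgue_measure_unique R (pushforward leb phi)) => //= _ [[a b]] _ <-.
rewrite /pushforward /=.
rewrite (_ : _ @^-1` _ = `](a - c)%R, (b - c)%R]%classic); last first.
  by apply/seteqP; split => x /=; rewrite !in_itv/= ltrBlDr lerBrDr.
rewrite !lebesgue_measure_itv/= !lte_fin ltrD2r.
by case: ifPn => // _; rewrite -!EFinD; congr EFin; ring.
Qed.

Lemma integral_lebesgue_opp (F : R -> \bar R) :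
  measurable_fun setT F -> (forall x, 0 <= F x) ->
  \int[leb]_x F (- x)%R = \int[leb]_x F x.
Proof.
move=> mF F0; apply: (ge0_integral_preserved (phi := -%R)) => // A mA.
by rewrite -[LHS]lebesgue_measureN.
Qed.

End lebesgueRn_theory.

(** * Linear maps preserving Lebesgue measure *)

Section orthogonal_invariance.
Context {R : realType}.
Local Notation leb := (@lebesgue_measure R).
Local Notation mu n := (lebesgueRn R n).
Implicit Types n d : nat.

(** Lebesgue measure lives on tuples while linear algebra lives on row vectors;
    this is the map t |-> t A transported to tuples. *)
Definition mulmx_tuple d (A : 'M[R]_d) (t : d.-tuple R) : d.-tuple R :=
  [tuple (row_of_tuple t *m A) 0 i | i < d].

Lemma row_mulmx_tuple d (A : 'M[R]_d) t : row_of_tuple (mulmx_tuple A t) = row_of_tuple t *m A.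
Proof. by apply/rowP => i; rewrite mxE tnth_mktuple. Qed.

Lemma mulmx_tupleM d (A B : 'M[R]_d) t : mulmx_tuple (A *m B) t = mulmx_tuple B (mulmx_tuple A t).
Proof. by apply: eq_from_tnth => i; rewrite !tnth_mktuple row_mulmx_tuple mulmxA. Qed.

Lemma measurable_coord d (i : 'I_d) :
  measurable_fun setT (fun t : d.-tuple R => row_of_tuple t 0 i).
Proof.
under eq_fun do rewrite mxE.
exact: measurable_tnth.
Qed.

Lemma measurable_dotp d (x : 'rV[R]_d) :
  measurable_fun setT (fun t : d.-tuple R => dotp x (row_of_tuple t)).
Proof.
apply: measurable_sum => i; apply: measurable_funM => //.
exact: measurable_coord.
Qed.

Lemma measurable_mulmx_tuple d (A : 'M[R]_d) : measurable_fun setT (@mulmx_tuple d A).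
Proof.
apply/measurable_fun_tnthP => i.
rewrite (_ : _ \o _ = fun t => dotp (\row_j A j i) (row_of_tuple t)).
  exact: measurable_dotp.
apply/funext => t /=; rewrite tnth_mktuple mxE.
by apply: eq_bigr => j _; rewrite !mxE mulrC.
Qed.

(** Invariance is stated for integrals rather than for measures of sets: this is
    the form in which Tonelli's theorem applies. *)
Definition preserves_lebesgue d (A : 'M[R]_d) := forall F : d.-tuple R -> \bar R,
  measurable_fun setT F -> (forall t, (0 <= F t)%E) ->
  (\int[mu d]_t F (mulmx_tuple A t) = \int[mu d]_t F t)%E.

Lemma preserves_lebesgue1 d : preserves_lebesgue (1%:M : 'M[R]_d).
Proof.
move=> F _ _; apply: eq_integral => t _; congr F.
by apply: eq_from_tnth => i; rewrite tnth_mktuple mulmx1 mxE.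
Qed.

Lemma preserves_lebesgueM d (A B : 'M[R]_d) :
  preserves_lebesgue A -> preserves_lebesgue B -> preserves_lebesgue (A *m B).
Proof.
move=> hA hB F mF F0; under eq_integral do rewrite mulmx_tupleM.
have mFB : measurable_fun setT (F \o mulmx_tuple B).
  by apply: measurableT_comp => //; exact: measurable_mulmx_tuple.
by rewrite (hA _ mFB (fun t => F0 _)); exact: hB.
Qed.

Lemma measurable_consRn_snd n (F : n.+1.-tuple R -> \bar R) (x : R) :
  measurable_fun setT F -> measurable_fun setT (fun t => F (consRn (x, t))).
Proof.
move=> mF; apply: (measurableT_comp mF).
exact: (measurableT_comp (@measurable_consRn R n) (pair1_measurable x)).
Qed.

Lemma measurable_consRn_fst n (F : n.+1.-tuple R -> \bar R) t :
  measurable_fun setT F ->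
  measurable_fun setT (fun x : measurableTypeR R => F (consRn (x, t))).
Proof.
move=> mF; apply: (measurableT_comp mF).
exact: (measurableT_comp (@measurable_consRn R n) (pair2_measurable t)).
Qed.

Lemma tnth_consRn0 n (z : R * n.-tuple R) : tnth (consRn z) ord0 = z.1.
Proof. by []. Qed.

Lemma tnth_consRnS n (z : R * n.-tuple R) i :
  tnth (consRn z) (lift ord0 i) = tnth z.2 i.
Proof. by rewrite tnthS. Qed.

Definition shift_coord n (j : 'I_n) (c : R) (t : n.-tuple R) : n.-tuple R :=
  [tuple tnth t i + c *+ (i == j) | i < n].

Lemma shift_coord0 n (c : R) z :
  shift_coord (@ord0 n) c (consRn z) = consRn (z.1 + c, z.2).
Proof.
apply: eq_from_tnth => i; rewrite tnth_mktuple.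
by case: (unliftP ord0 i) => [k|] ->; rewrite ?tnth_consRnS ?addr0// eqxx.
Qed.

Lemma shift_coordS n (j : 'I_n) (c : R) z :
  shift_coord (lift ord0 j) c (consRn z) = consRn (z.1, shift_coord j c z.2).
Proof.
apply: eq_from_tnth => i; rewrite tnth_mktuple.
case: (unliftP ord0 i) => [k|] ->; last by rewrite addr0.
by rewrite !tnth_consRnS tnth_mktuple (inj_eq lift_inj).
Qed.

Lemma measurable_shift_coord n (j : 'I_n) (c : R) :
  measurable_fun setT (shift_coord j c).
Proof.
apply/measurable_fun_tnthP => i.
rewrite (_ : _ \o _ = fun t => tnth t i + c *+ (i == j)).
  by apply: measurable_funD => //; exact: measurable_tnth.
by apply/funext => t /=; rewrite tnth_mktuple.
Qed.

Lemma integral_shift_coord n (j : 'I_n) (c : R) (F : n.-tuple R -> \bar R) :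
  measurable_fun setT F -> (forall t, (0 <= F t)%E) ->
  (\int[mu n]_t F (shift_coord j c t) = \int[mu n]_t F t)%E.
Proof.
elim: n j F => [[]//|n IH] j F mF F0.
have mFj : measurable_fun setT (F \o shift_coord j c).
  by apply: measurableT_comp => //; exact: measurable_shift_coord.
case: (unliftP ord0 j) mFj => [k|] -> mFj.
  rewrite (integral_lebesgueRnS mFj (fun t => F0 _)) (integral_lebesgueRnS mF F0).
  apply: eq_integral => x _; under eq_integral do rewrite /= shift_coordS/=.
  by rewrite (IH k (fun t => F (consRn (x, t))))//; exact: measurable_consRn_snd.
rewrite (integral_lebesgueRnS_swap mFj (fun t => F0 _)) (integral_lebesgueRnS_swap mF F0).
apply: eq_integral => t _; under eq_integral do rewrite /= shift_coord0/=.
rewrite (integral_lebesgue_shift _ (F := fun x => F (consRn (x, t))))//.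
exact: measurable_consRn_fst.
Qed.

Lemma row_of_tuple_delta d (t : d.-tuple R) (i j k : 'I_d) :
  (row_of_tuple t *m delta_mx i j) 0 k = tnth t i *+ (k == j).
Proof.
rewrite mxE (bigD1 i)//= big1 => [|l li]; rewrite !mxE ?eqxx ?mulr_natr ?addr0//.
by rewrite (negbTE li) mulr0n.
Qed.

Lemma mulmx_tuple_transvection d (i j : 'I_d) (a : R) t k :
  tnth (mulmx_tuple (1%:M + a *: delta_mx i j) t) k = tnth t k + a * tnth t i *+ (k == j).
Proof.
by rewrite tnth_mktuple mulmxDr mulmx1 -scalemxAr mxE [X in _ + X]mxE row_of_tuple_delta mxE mulrnAr.
Qed.

(** Adding a multiple of the first coordinate to another one is, for each fixed
    value of the first coordinate, a translation of the remaining ones. *)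
Lemma preserves_lebesgue_shear_from0 n (j : 'I_n) (a : R) :
  preserves_lebesgue (1%:M + a *: delta_mx ord0 (lift ord0 j)).
Proof.
move=> F mF F0; set A := (_ + _).
have mFA : measurable_fun setT (F \o mulmx_tuple A).
  by apply: measurableT_comp => //; exact: measurable_mulmx_tuple.
rewrite (integral_lebesgueRnS mFA (fun t => F0 _)) (integral_lebesgueRnS mF F0).
apply: eq_integral => x _.
rewrite -(integral_shift_coord j (a * x) (F := fun t => F (consRn (x, t))))//; last first.
  exact: measurable_consRn_snd.
apply: eq_integral => t _ /=; congr F; apply: eq_from_tnth => i.
rewrite mulmx_tuple_transvection; case: (unliftP ord0 i) => [k|] ->; last by rewrite addr0.
by rewrite !tnth_consRnS tnth_mktuple (inj_eq lift_inj).
Qed.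

(** Adding a multiple of another coordinate to the first one is a
    one-dimensional translation once the other coordinates are fixed. *)
Lemma preserves_lebesgue_shear_to0 n (j : 'I_n) (a : R) :
  preserves_lebesgue (1%:M + a *: delta_mx (lift ord0 j) ord0).
Proof.
move=> F mF F0; set A := (_ + _).
have mFA : measurable_fun setT (F \o mulmx_tuple A).
  by apply: measurableT_comp => //; exact: measurable_mulmx_tuple.
rewrite (integral_lebesgueRnS_swap mFA (fun t => F0 _)) (integral_lebesgueRnS_swap mF F0).
apply: eq_integral => t _.
rewrite -(integral_lebesgue_shift (a * tnth t j) (F := fun x => F (consRn (x, t))))//; last first.
  exact: measurable_consRn_fst.
apply: eq_integral => x _ /=; congr F; apply: eq_from_tnth => i.
rewrite mulmx_tuple_transvection tnth_consRnS.
by case: (unliftP ord0 i) => [k|] ->; rewrite ?addr0 // !tnth_consRnS.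
Qed.

Definition flip0_mx n : 'M[R]_n.+1 := 1%:M + (-2) *: delta_mx ord0 ord0.

Lemma preserves_lebesgue_flip0 n : preserves_lebesgue (flip0_mx n).
Proof.
move=> F mF F0.
have mFA : measurable_fun setT (F \o mulmx_tuple (flip0_mx n)).
  by apply: measurableT_comp => //; exact: measurable_mulmx_tuple.
rewrite (integral_lebesgueRnS_swap mFA (fun t => F0 _)) (integral_lebesgueRnS_swap mF F0).
apply: eq_integral => t _.
rewrite -(integral_lebesgue_opp (F := fun x => F (consRn (x, t))))//; last first.
  exact: measurable_consRn_fst.
apply: eq_integral => x _ /=; congr F; apply: eq_from_tnth => i.
rewrite mulmx_tuple_transvection.
case: (unliftP ord0 i) => [k|] ->; rewrite ?addr0 ?tnth_consRnS//.
by rewrite !tnth_consRn0/= mulr1n; ring.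
Qed.

End orthogonal_invariance.

(** * Rotating a vector onto the first axis *)

Section transitivity.
Context {R : realType}.
Implicit Types n d : nat.

Definition e0 n : 'rV[R]_n.+1 := delta_mx 0 ord0.

Lemma dotpC d (x y : 'rV[R]_d) : dotp x y = dotp y x.
Proof. by apply: eq_bigr => i _; rewrite mulrC. Qed.

Lemma dotpDl d (x y z : 'rV[R]_d) : dotp (x + y) z = dotp x z + dotp y z.
Proof. by rewrite -big_split; apply: eq_bigr => i _; rewrite mxE mulrDl. Qed.

Lemma dotpZl d a (x z : 'rV[R]_d) : dotp (a *: x) z = a * dotp x z.
Proof. by rewrite mulr_sumr; apply: eq_bigr => i _; rewrite mxE mulrA. Qed.

Lemma dotp_delta d (i : 'I_d) (x : 'rV[R]_d) : dotp (delta_mx 0 i) x = x 0 i.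
Proof.
rewrite /dotp (bigD1 i)//= big1 => [|j ji]; rewrite !mxE ?eqxx ?mul1r ?addr0//.
by rewrite (negbTE ji) mul0r.
Qed.

Lemma dotp_ge0 d (x : 'rV[R]_d) : 0 <= dotp x x.
Proof. by apply: sumr_ge0 => i _; rewrite -expr2 sqr_ge0. Qed.

Lemma sqr_enorm d (x : 'rV[R]_d) : enorm x ^+ 2 = dotp x x.
Proof. by rewrite sqr_sqrtr// dotp_ge0. Qed.

Lemma enorm_ge0 d (x : 'rV[R]_d) : 0 <= enorm x.
Proof. exact: sqrtr_ge0. Qed.

Lemma enormZ d a (x : 'rV[R]_d) : enorm (a *: x) = `|a| * enorm x.
Proof.
by rewrite /enorm dotpZl dotpC dotpZl mulrA -expr2 sqrtrM ?sqr_ge0// sqrtr_sqr.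
Qed.

Lemma dotp_split n (j : 'I_n) (x y : 'rV[R]_n.+1) :
  dotp x y = x 0 ord0 * y 0 ord0 + x 0 (lift ord0 j) * y 0 (lift ord0 j) +
    \sum_(i < n | i != j) x 0 (lift ord0 i) * y 0 (lift ord0 i).
Proof. by rewrite /dotp big_ord_recl (bigD1 j)//= addrA. Qed.

(** Products of shears and of one reflection supply enough orthogonal matrices,
    so the invariance of the measure is carried along as part of the definition
    instead of being derived from orthogonality. *)
Definition lebesgue_isometry d (A : 'M[R]_d) :=
  (forall x y, dotp (x *m A) (y *m A) = dotp x y) /\ preserves_lebesgue A.

Lemma lebesgue_isometry1 d : lebesgue_isometry (1%:M : 'M[R]_d).
Proof. by split=> [x y|]; [rewrite !mulmx1|exact: preserves_lebesgue1]. Qed.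

Lemma lebesgue_isometryM d (A B : 'M[R]_d) :
  lebesgue_isometry A -> lebesgue_isometry B -> lebesgue_isometry (A *m B).
Proof.
move=> [oA pA] [oB pB]; split=> [x y|]; last exact: preserves_lebesgueM.
by rewrite !mulmxA oB oA.
Qed.

Lemma mul_transvection d (i j : 'I_d) (a : R) (x : 'rV[R]_d) k :
  (x *m (1%:M + a *: delta_mx i j)) 0 k = x 0 k + a * x 0 i *+ (k == j).
Proof.
rewrite mulmxDr mulmx1 -scalemxAr mxE [X in _ + X]mxE -mulrnAr.
congr (_ + _ * _); rewrite mxE (bigD1 i)//= big1 => [|l li].
  by rewrite !mxE eqxx mulr_natr addr0.
by rewrite !mxE (negbTE li) mulr0.
Qed.

(** The rotation of angle t in the plane of the coordinates 0 and j.+1, with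
    c = cos t and s = sin t, as a product of three shears (the first and last
    have coefficient - tan (t / 2) = (c - 1) / s). *)
Definition givens n (j : 'I_n) (c s : R) : 'M[R]_n.+1 :=
  let S := 1%:M + ((c - 1) / s) *: delta_mx (lift ord0 j) ord0 in
  S *m (1%:M + s *: delta_mx ord0 (lift ord0 j)) *m S.

Lemma mul_givens n (j : 'I_n) c s (x : 'rV[R]_n.+1) : s != 0 -> c ^+ 2 + s ^+ 2 = 1 ->
  [/\ (x *m givens j c s) 0 ord0 = c * x 0 ord0 - s * x 0 (lift ord0 j),
      (x *m givens j c s) 0 (lift ord0 j) = s * x 0 ord0 + c * x 0 (lift ord0 j) &
      forall i, i != j -> (x *m givens j c s) 0 (lift ord0 i) = x 0 (lift ord0 i)].
Proof.
move=> s0 cs; rewrite /givens; set p := (c - 1) / s.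
have sp : s * p = c - 1 by rewrite /p; field.
have pc : p * (c + 1) = - s.
  apply: (mulfI s0); rewrite mulrA sp mulrN -expr2.
  by have -> : (c - 1) * (c + 1) = c ^+ 2 - 1; [ring | rewrite -cs; ring].
split=> [||i ij]; rewrite !mulmxA !mul_transvection ?eqxx/= ?mulr1n ?addr0.
- apply/eqP; rewrite -subr_eq0; apply/eqP.
  set x0 := x 0 ord0; set xj := x 0 _.
  transitivity (x0 * (s * p - (c - 1)) + xj * (p * (c + 1) + s)
    + p * xj * (s * p - (c - 1))); first ring.
  by rewrite sp pc; ring.
- have -> : c = 1 + s * p by rewrite sp; ring.
  by ring.
- by rewrite (inj_eq lift_inj) (negbTE ij) mulr0n !addr0.
Qed.

Lemma givens_isometry n (j : 'I_n) c s : s != 0 -> c ^+ 2 + s ^+ 2 = 1 ->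
  lebesgue_isometry (givens j c s).
Proof.
move=> s0 cs; split=> [x y|].
  have [x0 xj xi] := mul_givens j x s0 cs; have [y0 yj yi] := mul_givens j y s0 cs.
  rewrite !(dotp_split j) x0 xj y0 yj; congr (_ + _); last first.
    by apply: eq_bigr => i ij; rewrite xi// yi.
  transitivity ((c ^+ 2 + s ^+ 2) *
    (x 0 ord0 * y 0 ord0 + x 0 (lift ord0 j) * y 0 (lift ord0 j))); first ring.
  by rewrite cs mul1r.
apply: preserves_lebesgueM; first apply: preserves_lebesgueM.
- exact: preserves_lebesgue_shear_to0.
- exact: preserves_lebesgue_shear_from0.
- exact: preserves_lebesgue_shear_to0.
Qed.

Lemma flip0_isometry n : lebesgue_isometry (@flip0_mx R n).
Proof.
split; last exact: preserves_lebesgue_flip0.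
move=> x y; rewrite /dotp !big_ord_recl !mul_transvection/= !mulr1n.
congr (_ + _); first ring.
by apply: eq_bigr => i _; rewrite !mul_transvection/= !addr0.
Qed.

Lemma enorm_isometry d (A : 'M[R]_d) (x : 'rV[R]_d) :
  lebesgue_isometry A -> enorm (x *m A) = enorm x.
Proof. by move=> [oA _]; rewrite /enorm oA. Qed.

(** Givens rotations cancel the coordinates one after the other, which leaves
    a vector on the first axis; the reflection fixes its sign. *)
Lemma exists_isometry_to_axis n (x : 'rV[R]_n.+1) :
  exists2 A, lebesgue_isometry A & x *m A = enorm x *: e0 n.
Proof.
have [A iA zA] : exists2 A, lebesgue_isometry A &
    forall j, j \in enum 'I_n -> (x *m A) 0 (lift ord0 j) = 0.
  elim: (enum 'I_n) => [|j s [A iA zA]]; first by exists 1%:M => //; exact: lebesgue_isometry1.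
  have [vj0|vj0] := eqVneq ((x *m A) 0 (lift ord0 j)) 0.
    by exists A => // i; rewrite inE => /predU1P[->//|/zA].
  set v := x *m A in vj0 zA.
  pose r := Num.sqrt (v 0 ord0 ^+ 2 + v 0 (lift ord0 j) ^+ 2).
  have v2 : 0 < v 0 (lift ord0 j) ^+ 2 by rewrite exprn_even_gt0.
  have r2 : r ^+ 2 = v 0 ord0 ^+ 2 + v 0 (lift ord0 j) ^+ 2.
    by rewrite sqr_sqrtr// addr_ge0 ?sqr_ge0.
  have r0 : r != 0 by rewrite -sqrf_eq0 r2 gt_eqF// ltr_wpDl ?sqr_ge0.
  pose c := v 0 ord0 / r; pose t := - v 0 (lift ord0 j) / r.
  have t0 : t != 0 by rewrite mulf_neq0 ?oppr_eq0 ?invr_eq0.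
  have ct : c ^+ 2 + t ^+ 2 = 1.
    by rewrite !expr_div_n sqrrN -mulrDl -r2 divff// expf_neq0.
  (* the rotation that cancels the coordinate j.+1 of x A *)
  exists (A *m givens j c t).
    by apply: lebesgue_isometryM => //; exact: givens_isometry.
  move=> i; rewrite mulmxA -/v; have [_ vj vi] := mul_givens j v t0 ct.
  have [->|ij] := eqVneq i j; first by rewrite vj /c /t => _; ring.
  by rewrite inE (negbTE ij) vi//=; exact: zA.
have xA : x *m A = (x *m A) 0 ord0 *: e0 n.
  move: (x *m A) zA => v zv; apply/rowP => i; rewrite mxE /e0 mxE eqxx/=.
  case: (unliftP ord0 i) => [k|] ->; rewrite /= ?mulr1// mulr0.
  by rewrite zv// mem_enum.
have e01 : enorm (e0 n) = 1.
  by rewrite /enorm dotp_delta mxE !eqxx sqrtr1.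
have nx : enorm x = `|(x *m A) 0 ord0|.
  by rewrite -(enorm_isometry x iA) {1}xA enormZ e01 mulr1.
have [v0|v0] := leP 0 ((x *m A) 0 ord0).
  by exists A => //; rewrite nx ger0_norm.
exists (A *m @flip0_mx R n); first by apply: lebesgue_isometryM => //; exact: flip0_isometry.
rewrite mulmxA nx ltr0_norm//; move: (x *m A) xA => v ->.
apply/rowP => i; rewrite mul_transvection !mxE eqxx/=.
case: (unliftP ord0 i) => [k|] ->; rewrite /=.
  by rewrite addr0 !mulr0.
by rewrite !mulr1n; ring.
Qed.

End transitivity.

(** * Integrals against a radial weight *)

Section radial_weights.
Context {R : realType}.
Implicit Types n d : nat.
Local Notation mu d := (lebesgueRn R d).

Definition measurable_row d (h : 'rV[R]_d -> R) :=
  measurable_fun setT (fun t : d.-tuple R => h (row_of_tuple t)).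

Lemma measurable_enorm d : measurable_row (@enorm R d).
Proof.
apply: (measurableT_comp (f := @Num.sqrt R)).
  by apply: continuous_measurable_fun; exact: sqrt_continuous.
apply: measurable_sum => i; apply: measurable_funM; exact: measurable_coord.
Qed.

Lemma dotp_isometry_axis n (x : 'rV[R]_n.+1) : exists2 A, lebesgue_isometry A &
  forall y, dotp x y = enorm x * dotp (e0 n) (y *m A).
Proof.
have [A iA xA] := exists_isometry_to_axis x; exists A => // y.
by rewrite -(iA.1 x y) xA dotpZl.
Qed.

(** Cauchy-Schwarz, by rotating x onto the first axis. *)
Lemma sqr_dotp_le n (x y : 'rV[R]_n.+1) :
  dotp x y ^+ 2 <= enorm x ^+ 2 * enorm y ^+ 2.
Proof.
have [A iA ->] := dotp_isometry_axis x.
rewrite exprMn ler_wpM2l ?sqr_ge0// -(enorm_isometry y iA) sqr_enorm dotp_delta.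
rewrite /dotp big_ord_recl -expr2 lerDl.
by apply: sumr_ge0 => i _; rewrite -expr2 sqr_ge0.
Qed.

Section weight.
Context n (w : R -> R) (delta S : R).
Local Notation d := n.+1.

(** All three kernels fit this pattern: omega and tilde omega directly, and
    hat omega through r |-> hat omega(r) / r, whose second moment is the first
    moment of hat omega. *)
Record radial_weight : Prop := RadialWeight {
  weight_measurable : measurable_fun (`[0, +oo[%classic : set R) w;
  weight_ge0 : forall r, 0 <= r -> 0 <= w r;
  weight_supp : forall r, delta < r -> w r = 0;
  weight_moment : moment d 2 w = S%:E
}.

Definition radial_int (h : 'rV[R]_d -> R) : R :=
  \int[mu d]_t (w (enorm (row_of_tuple t)) * h (row_of_tuple t)).

(** Since only the second moment of a weight is controlled, these are the
    functions that can be integrated against it, even when the kernel itself is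
    not integrable at the origin. *)
Definition quadratic_bound (h : 'rV[R]_d -> R) : Prop :=
  measurable_row h /\ exists K, forall s, `|h s| <= K * enorm s ^+ 2.

Hypothesis W : radial_weight.

Lemma measurable_weight : measurable_row (fun s : 'rV[R]_d => w (enorm s)).
Proof.
apply: (measurable_comp _ _ (weight_measurable W)).
- exact: measurable_itv.
- by move=> _ [t _ <-] /=; rewrite in_itv/= enorm_ge0.
- exact: measurable_enorm.
Qed.

Lemma radial_int_integrable h : quadratic_bound h ->
  (mu d).-integrable setT
    (EFin \o (fun t => w (enorm (row_of_tuple t)) * h (row_of_tuple t))).
Proof.
move=> [mh [K hK]].
have iM : (mu d).-integrable setT (EFin \o (fun t =>
    w (enorm (row_of_tuple t)) * enorm (row_of_tuple t : 'rV[R]_d) ^+ 2)).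
  have mM : measurable_fun setT (fun t : d.-tuple R =>
      w (enorm (row_of_tuple t)) * enorm (row_of_tuple t : 'rV[R]_d) ^+ 2).
    apply: measurable_funM; first exact: measurable_weight.
    by apply: measurable_funX; exact: measurable_enorm.
  apply/integrableP; split; first exact/measurable_EFinP.
  under eq_integral do rewrite /= ger0_norm ?mulr_ge0 ?sqr_ge0 ?(weight_ge0 W) ?enorm_ge0//.
  by move: (weight_moment W); rewrite /moment /= => ->; rewrite ltry.
apply: (le_integrable measurableT _ _ (integrableZl measurableT K iM)).
  apply/measurable_EFinP; apply: measurable_funM => //; exact: measurable_weight.
move=> t _ /=; rewrite lee_fin !normrM.
have w0 := weight_ge0 W (enorm_ge0 (row_of_tuple t : 'rV_d)).
rewrite mulrCA ler_wpM2l// (le_trans (hK _))//.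
by rewrite -!normrM ler_norm.
Qed.

Lemma radial_int_ext h1 h2 : (forall s, h1 s = h2 s) -> radial_int h1 = radial_int h2.
Proof. by move=> h12; apply: eq_Rintegral => t _; rewrite h12. Qed.

Lemma radial_intD h1 h2 : quadratic_bound h1 -> quadratic_bound h2 ->
  radial_int (fun s => h1 s + h2 s) = radial_int h1 + radial_int h2.
Proof.
move=> q1 q2; rewrite /radial_int; under eq_Rintegral do rewrite mulrDr.
by rewrite RintegralD//; exact: radial_int_integrable.
Qed.

Lemma radial_intZ a h : quadratic_bound h -> radial_int (fun s => a * h s) = a * radial_int h.
Proof.
move=> q; rewrite /radial_int; under eq_Rintegral do rewrite mulrCA.
by rewrite RintegralZl//; exact: radial_int_integrable.
Qed.

Lemma quadratic_boundD h1 h2 : quadratic_bound h1 -> quadratic_bound h2 ->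
  quadratic_bound (fun s => h1 s + h2 s).
Proof.
move=> [m1 [K1 b1]] [m2 [K2 b2]]; split; first exact: measurable_funD.
exists (K1 + K2) => s; rewrite mulrDl (le_trans (ler_normD _ _))//.
by rewrite lerD.
Qed.

Lemma quadratic_boundZ a h : quadratic_bound h -> quadratic_bound (fun s => a * h s).
Proof.
move=> [mh [K b]]; split; first exact: measurable_funM.
by exists (`|a| * K) => s; rewrite normrM -mulrA ler_wpM2l.
Qed.

Lemma quadratic_bound_sum I (r : seq I) h : (forall i, quadratic_bound (h i)) ->
  quadratic_bound (fun s => \sum_(i <- r) h i s).
Proof.
move=> qh; elim: r => [|i r IH].
  rewrite /quadratic_bound /measurable_row.
  split; first by under eq_fun do rewrite big_nil; exact: measurable_cst.
  by exists 0 => s; rewrite big_nil normr0 mul0r.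
by under eq_fun do rewrite big_cons; exact: quadratic_boundD.
Qed.

Lemma radial_int_sum I (r : seq I) h : (forall i, quadratic_bound (h i)) ->
  radial_int (fun s => \sum_(i <- r) h i s) = \sum_(i <- r) radial_int (h i).
Proof.
move=> qh; elim: r => [|i r IH].
  have q0 : quadratic_bound (cst 0).
    by split; [exact: measurable_cst|exists 0 => s; rewrite normr0 mul0r].
  rewrite big_nil -[RHS](mul0r (radial_int (cst 0))) -(radial_intZ 0 q0).
  by apply: radial_int_ext => s; rewrite big_nil mul0r.
rewrite big_cons -IH -radial_intD//; last exact: quadratic_bound_sum.
by apply: radial_int_ext => s; rewrite big_cons.
Qed.

(** The comparison is only required on the ball that supports the weight, which
    is what turns fourth-order remainders into second-order terms. *)
Lemma le_radial_int h1 h2 : quadratic_bound h1 -> quadratic_bound h2 ->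
  (forall s, enorm s <= delta -> h1 s <= h2 s) -> radial_int h1 <= radial_int h2.
Proof.
move=> q1 q2 h12; apply: le_Rintegral => //; try exact: radial_int_integrable.
move=> t _; have [sd|sd] := leP (enorm (row_of_tuple t : 'rV[R]_d)) delta.
  by rewrite ler_wpM2l ?h12// (weight_ge0 W)// enorm_ge0.
by rewrite (weight_supp W)// !mul0r.
Qed.

Lemma radial_int_isometry A h : lebesgue_isometry A -> measurable_row h ->
  radial_int (fun s => h (s *m A)) = radial_int h.
Proof.
move=> iA mh; rewrite /radial_int /Rintegral; congr fine.
pose F t := (w (enorm (row_of_tuple t)) * h (row_of_tuple t))%:E.
have mF : measurable_fun setT (F : d.-tuple R -> \bar R).
  by apply/measurable_EFinP; apply: measurable_funM => //; exact: measurable_weight.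
transitivity (\int[mu d]_t F (mulmx_tuple A t))%E.
  by apply: eq_integral => t _; rewrite /F row_mulmx_tuple (enorm_isometry _ iA).
rewrite [LHS]integralE.
transitivity (\int[mu d]_t F^\+ t - \int[mu d]_t F^\- t)%E; last by rewrite -integralE.
congr (_ - _)%E.
- by rewrite -[RHS](iA.2 _ (measurable_funepos mF))// (funepos_comp F (mulmx_tuple A)).
- by rewrite -[RHS](iA.2 _ (measurable_funeneg mF))// (funeneg_comp F (mulmx_tuple A)).
Qed.

Lemma measurable_row_dotp (phi : R -> R) x :
  measurable_fun setT phi -> measurable_row (fun s : 'rV[R]_d => phi (dotp x s)).
Proof. by move=> mphi; apply: (measurableT_comp mphi); exact: measurable_dotp. Qed.

(** Rotating x onto the first axis: the integral of a function of the scalar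
    product with x depends on |x| only. *)
Lemma radial_int_plane_wave (phi : R -> R) x : measurable_fun setT phi ->
  radial_int (fun s => phi (dotp x s)) = radial_int (fun s => phi (enorm x * dotp (e0 n) s)).
Proof.
move=> mphi; have [A iA xA] := dotp_isometry_axis x.
rewrite -(radial_int_isometry (h := fun s => phi (enorm x * dotp (e0 n) s)) iA).
  by apply: radial_int_ext => s; rewrite xA.
under eq_fun do rewrite -dotpZl.
exact: measurable_row_dotp.
Qed.

Lemma sqr_quadratic_bound x : quadratic_bound (fun s => dotp x s ^+ 2).
Proof.
split; first by apply: (measurable_row_dotp (phi := fun u => u ^+ 2)); exact: exprn_measurable.
exists (enorm x ^+ 2) => s; rewrite ger0_norm ?sqr_ge0//; exact: sqr_dotp_le.
Qed.

Lemma enorm_e0 : enorm (e0 n : 'rV[R]_d) = 1.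
Proof. by rewrite /enorm dotp_delta mxE !eqxx sqrtr1. Qed.

(** Isotropy of the second moments: the d coordinates contribute equally, and
    their contributions add up to the second moment S. *)
Lemma radial_int_sqr x : radial_int (fun s => dotp x s ^+ 2) = S / d%:R * enorm x ^+ 2.
Proof.
have qe i := sqr_quadratic_bound (delta_mx 0 i).
have mX2 : measurable_fun setT (fun u : R => u ^+ 2) by exact: exprn_measurable.
have wx y : radial_int (fun s => dotp y s ^+ 2) =
    enorm y ^+ 2 * radial_int (fun s => dotp (e0 n) s ^+ 2).
  rewrite (radial_int_plane_wave _ mX2) -radial_intZ; last exact: sqr_quadratic_bound.
  by apply: radial_int_ext => s; rewrite exprMn.
have e1 i : enorm (delta_mx 0 i : 'rV[R]_d) = 1.
  by rewrite /enorm dotp_delta mxE !eqxx sqrtr1.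
have wi i : radial_int (fun s => dotp (delta_mx 0 i) s ^+ 2) = radial_int (fun s => dotp (e0 n) s ^+ 2).
  by rewrite wx e1 expr1n mul1r.
have : radial_int (fun s => \sum_(i < d) dotp (delta_mx 0 i) s ^+ 2) = S.
  transitivity (fine (moment d 2 w)); last by rewrite (weight_moment W).
  congr fine; apply: eq_integral => t _ /=; congr (_ * _)%:E.
  by rewrite sqr_enorm; apply: eq_bigr => i _; rewrite dotp_delta expr2.
rewrite radial_int_sum//; under eq_bigr do rewrite wi.
rewrite sumr_const card_ord => <-; rewrite wx.
by rewrite -mulr_natl; field; rewrite addrC natr1.
Qed.

End weight.
End radial_weights.

(** * Symbols of radial kernels at low frequency *)

Section radial_symbols.
Context {R : realType} {n : nat} (w : R -> R) (delta S : R).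
Local Notation d := n.+1.
Hypotheses (delta0 : 0 < delta) (W : radial_weight n w delta S).
Local Notation Q := (S / d%:R).

Lemma weight_moment_ge0 : 0 <= Q.
Proof.
have := radial_int_sqr W (e0 n); rewrite enorm_e0 expr1n mulr1 => <-.
apply: Rintegral_ge0 => t _.
by rewrite mulr_ge0 ?sqr_ge0// (weight_ge0 W)// enorm_ge0.
Qed.

Definition cos_symbol (x : 'rV[R]_d) := radial_int w (fun s => 1 - cos (dotp x s)).

Lemma quadratic_bound_cos x : quadratic_bound (fun s : 'rV[R]_d => 1 - cos (dotp x s)).
Proof.
split.
  apply: (measurable_row_dotp (phi := fun u => 1 - cos u)).
  apply: measurable_funB => //; apply: continuous_measurable_fun; exact: continuous_cos.
exists (enorm x ^+ 2 / 2) => s; rewrite ger0_norm ?subr_ge0 ?cos_le1//.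
apply: (le_trans (one_sub_cos_le _)); rewrite [leRHS]mulrAC ler_wpM2r ?invr_ge0//.
exact: sqr_dotp_le.
Qed.

Lemma cos_symbol_le x : cos_symbol x <= Q / 2 * enorm x ^+ 2.
Proof.
rewrite mulrAC -(radial_int_sqr W) mulrC -(radial_intZ W); last exact: sqr_quadratic_bound.
apply: (le_radial_int W).
- exact: quadratic_bound_cos.
- by apply: quadratic_boundZ; exact: sqr_quadratic_bound.
- by move=> s _; rewrite mulrC; exact: one_sub_cos_le.
Qed.

(** On the support |x.s| <= delta |x|, so the quartic Taylor remainder is at most
    a small multiple of the quadratic term. *)
Lemma cos_symbol_ge x :
  Q / 2 * enorm x ^+ 2 * (1 - (delta * enorm x) ^+ 2 / 12) <= cos_symbol x.
Proof.
have -> : Q / 2 * enorm x ^+ 2 * (1 - (delta * enorm x) ^+ 2 / 12) =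
   (2^-1 - (delta * enorm x) ^+ 2 / 24) * (Q * enorm x ^+ 2) by field.
rewrite -(radial_int_sqr W) -(radial_intZ W); last exact: sqr_quadratic_bound.
apply: (le_radial_int W).
- by apply: quadratic_boundZ; exact: sqr_quadratic_bound.
- exact: quadratic_bound_cos.
move=> s sd; apply: le_trans (one_sub_cos_ge _).
set t := dotp x s; have t2 : t ^+ 2 <= (delta * enorm x) ^+ 2.
  apply: (le_trans (sqr_dotp_le _ _)); rewrite exprMn [leRHS]mulrC ler_wpM2l ?sqr_ge0//.
  by rewrite lerXn2r// nnegrE ?enorm_ge0// ltW.
have -> : t ^+ 4 = t ^+ 2 * t ^+ 2 by ring.
have := ler_wpM2r (sqr_ge0 t) t2; lra.
Qed.

Lemma cos_symbol_radial x : cos_symbol x = cos_symbol (enorm x *: e0 n).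
Proof.
rewrite /cos_symbol (radial_int_plane_wave W (phi := fun u => 1 - cos u)).
  by apply: radial_int_ext => s; rewrite dotpZl.
apply: measurable_funB => //; apply: continuous_measurable_fun; exact: continuous_cos.
Qed.

Definition sin_symbol (y x : 'rV[R]_d) := radial_int w (fun s => dotp y s * sin (dotp x s)).

Lemma quadratic_bound_sin y x :
  quadratic_bound (fun s : 'rV[R]_d => dotp y s * sin (dotp x s)).
Proof.
split.
  apply: measurable_funM; first exact: measurable_dotp.
  apply: (measurable_row_dotp (phi := @sin R)).
  by apply: continuous_measurable_fun; exact: continuous_sin.
exists (enorm y * enorm x) => s.
have sinn (u : R) : `|sin u| <= `|u|.
  wlog u0 : u / 0 <= u => [H|].
    have [/H//|/ltW] := leP 0 u; rewrite -oppr_ge0 => /H.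
    by rewrite sinN !normrN.
  rewrite (ger0_norm u0) ler_norml sin_le_id// andbT.
  have [u1|/ltW u1] := leP u 1; last by rewrite (le_trans _ (sin_geN1 _))// lerN2.
  rewrite (le_trans _ (sin_ge_cubic u0))// -subr_ge0.
  have -> : u - u ^+ 3 / 6 - - u = u * (2 - u ^+ 2 / 6) by field.
  rewrite mulr_ge0// subr_ge0; have : u ^+ 2 <= 1 by rewrite exprn_ile1.
  lra.
have dn (z : 'rV[R]_d) : `|dotp z s| <= enorm z * enorm s.
  rewrite -ler_sqr ?nnegrE ?mulr_ge0 ?enorm_ge0// real_normK ?num_real//.
  by rewrite exprMn sqr_dotp_le.
rewrite normrM expr2 mulrACA ler_pM// (le_trans (sinn _))//.
Qed.

Lemma mul_flip0 (x : 'rV[R]_d) j :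
  (x *m flip0_mx n) 0 j = if j == ord0 then - x 0 j else x 0 j.
Proof.
rewrite mul_transvection; case: eqP => [->|_]; last by rewrite mulr0n addr0.
by rewrite mulr1n; ring.
Qed.

(** The reflection of the first coordinate changes the sign of the integrand. *)
Lemma sin_symbol_orth_axis k (z : 'rV[R]_d) : z 0 ord0 = 0 -> sin_symbol z (k *: e0 n) = 0.
Proof.
move=> z0; have [mz _] := quadratic_bound_sin z (k *: e0 n).
have := radial_int_isometry W (flip0_isometry n) mz.
have q := quadratic_bound_sin z (k *: e0 n).
rewrite (_ : radial_int _ _ = - sin_symbol z (k *: e0 n)); first by rewrite -/(sin_symbol _ _); lra.
rewrite -mulN1r -(radial_intZ W)//; apply: radial_int_ext => s.
rewrite !dotpZl !dotp_delta mul_flip0 eqxx mulrN sinN mulN1r mulrN.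
congr (- (_ * _)); apply: eq_bigr => j _; rewrite mul_flip0.
by case: eqP => // ->; rewrite z0 !mul0r.
Qed.

Definition radial_sin_symbol (k : R) := sin_symbol (e0 n) (k *: e0 n).

Lemma sub_axis_coord0 (v : 'rV[R]_d) : (v - v 0 ord0 *: e0 n) 0 ord0 = 0.
Proof. by rewrite !mxE !eqxx mulr1 subrr. Qed.

(** The symbol of the nonlocal gradient is parallel to the frequency: rotate x
    onto the first axis, and split y into its components along and orthogonal to
    x; the second one does not contribute. *)
Lemma sin_symbolE y x : x != 0 ->
  sin_symbol y x = radial_sin_symbol (enorm x) * (dotp y x / enorm x).
Proof.
move=> x0; have [A iA xA] := exists_isometry_to_axis x.
have k0 : enorm x != 0.
  apply: contra x0 => /eqP k0; apply/eqP.
  have : x *m A = 0 by rewrite xA k0 scale0r.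
  move=> xA0; apply/rowP => i; rewrite mxE -(dotp_delta i x) -iA.1 xA0.
  by rewrite dotpC -(scale0r 0) dotpZl mul0r.
set k := enorm x in xA k0 *; set v := y *m A; set a := v 0 ord0.
have -> : sin_symbol y x = sin_symbol v (k *: e0 n).
  have [mh _] := quadratic_bound_sin v (k *: e0 n).
  rewrite /sin_symbol -(radial_int_isometry W iA mh); apply: radial_int_ext => s.
  by rewrite -(iA.1 y s) -(iA.1 x s) xA.
have -> : dotp y x / k = a.
  by rewrite -(iA.1 y x) xA dotpC dotpZl dotp_delta mulrAC mulfV// mul1r.
pose z := v - a *: e0 n.
have z0 : z 0 ord0 = 0 by rewrite sub_axis_coord0.
have -> : sin_symbol v (k *: e0 n) = a * radial_sin_symbol k + sin_symbol z (k *: e0 n).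
  rewrite /radial_sin_symbol /sin_symbol -(radial_intZ W); last exact: quadratic_bound_sin.
  rewrite -(radial_intD W); last exact: quadratic_bound_sin.
    apply: radial_int_ext => s; rewrite mulrA -mulrDl -dotpZl -dotpDl.
    by rewrite /z addrC subrK.
  by apply: quadratic_boundZ; exact: quadratic_bound_sin.
by rewrite sin_symbol_orth_axis// addr0 mulrC.
Qed.

Lemma radial_sin_symbol_le k : 0 <= k -> radial_sin_symbol k <= k * Q.
Proof.
move=> k0; have := radial_int_sqr W (e0 n); rewrite enorm_e0 expr1n mulr1 => <-.
rewrite -(radial_intZ W); last exact: sqr_quadratic_bound.
apply: (le_radial_int W); first exact: quadratic_bound_sin.
  by apply: quadratic_boundZ; exact: sqr_quadratic_bound.
move=> s _; rewrite dotpZl; move: (dotp _ _) => t.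
wlog t0 : t / 0 <= t => [H|].
  have [/H//|/ltW] := leP 0 t; rewrite -oppr_ge0 => /H.
  by rewrite mulrN sinN mulrNN sqrrN.
by rewrite expr2 mulrCA ler_wpM2l// sin_le_id// mulr_ge0.
Qed.

Lemma radial_sin_symbol_ge k : 0 <= k ->
  k * Q * (1 - (delta * k) ^+ 2 / 6) <= radial_sin_symbol k.
Proof.
move=> k0; have := radial_int_sqr W (e0 n); rewrite enorm_e0 expr1n mulr1 => <-.
rewrite mulrAC -(radial_intZ W); last exact: sqr_quadratic_bound.
apply: (le_radial_int W); last 1 first.
- move=> s sd; rewrite dotpZl.
  have : dotp (e0 n) s ^+ 2 <= delta ^+ 2.
    apply: (le_trans (sqr_dotp_le _ _)); rewrite enorm_e0 expr1n mul1r.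
    by rewrite lerXn2r// nnegrE ?enorm_ge0// ltW.
  move: (dotp _ _) => t.
  wlog t0 : t / 0 <= t => [H|].
    have [/H//|/ltW] := leP 0 t; rewrite -oppr_ge0 => /H.
    by rewrite mulrN sinN mulrNN sqrrN.
  move=> td; have kt := ler_wpM2l t0 (sin_ge_cubic (mulr_ge0 k0 t0)).
  apply: le_trans kt; rewrite -subr_ge0.
  have -> : t * (k * t - (k * t) ^+ 3 / 6) - k * (1 - (delta * k) ^+ 2 / 6) * t ^+ 2
    = k * t ^+ 2 * k ^+ 2 / 6 * (delta ^+ 2 - t ^+ 2) by field.
  by rewrite mulr_ge0 ?subr_ge0// divr_ge0// !mulr_ge0 ?sqr_ge0.
- by apply: quadratic_boundZ; exact: sqr_quadratic_bound.
- exact: quadratic_bound_sin.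
Qed.

End radial_symbols.

(** * Coercivity of the diffusion symbol at high frequency *)

Section box_measure.
Context {R : realType}.
Local Notation leb := (@lebesgue_measure R).
Local Notation mu n := (lebesgueRn R n).

Lemma lebesgueRnS_rect n (B : set (n.+1.-tuple R)) (I : set (measurableTypeR R))
    (J : set (n.-tuple R)) :
  measurable I -> measurable J -> @consRn R n @^-1` B = I `*` J ->
  mu n.+1 B = (leb I * mu n J)%E.
Proof.
move=> mI mJ BE; rewrite -[LHS]/((leb \x mu n)%E (@consRn R n @^-1` B)) BE.
exact: product_measure1E.
Qed.

Definition cube n (c : R) : set (n.-tuple R) :=
  [set t | forall i, `[0, c]%classic (tnth t i)].

Lemma measurable_cube n c : measurable (@cube n c).
Proof.
rewrite (_ : cube _ = \bigcap_(i in [set: 'I_n])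
    ((fun t : n.-tuple R => tnth t i) @^-1` `[0, c]%classic)).
  apply: fin_bigcap_measurable => [|i _]; first by [].
  rewrite -[X in measurable X]setTI; exact: measurable_tnth.
by apply/seteqP; split => [t tc i _|t tc i]; [exact: tc|exact: tc i Logic.I].
Qed.

Definition slab n (I : set R) (c : R) : set (n.+1.-tuple R) :=
  [set t | I (tnth t ord0) /\ forall i, `[0, c]%classic (tnth t (lift ord0 i))].

Lemma consRn_slab n (I : set R) (c : R) : @consRn R n @^-1` (slab I c) = I `*` @cube n c.
Proof.
apply/seteqP; split => [[x t] [/= Ix tc]|[x t] [/= Ix tc]]; split => //= i.
  by move: (tc i); rewrite tnth_consRnS.
by move: (tc i); rewrite tnth_consRnS.
Qed.

Lemma lebesgueRn_cube n (c : R) : 0 <= c -> mu n (@cube n c) = (c ^+ n)%:E.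
Proof.
move=> c0; elim: n => [|n IH].
  rewrite /= diracE mem_set//; first by case.
rewrite (_ : cube _ = slab `[0, c]%classic c).
  rewrite (lebesgueRnS_rect _ (@measurable_cube n c) (@consRn_slab _ _ _)).
    rewrite IH lebesgue_measure_itv/= lte_fin exprS EFinM.
    case: ltP => [_|c1]; first by rewrite oppr0 adde0.
    by rewrite (_ : c = 0) ?mul0e//; apply/le_anti; rewrite c0 c1.
  exact: measurable_itv.
apply/seteqP; split => [t tc|t [t0 tc] i]; first by split => [|i]; exact: tc.
by case: (unliftP ord0 i) => [k|] ->.
Qed.

Lemma measurable_slab n (a b c : R) : measurable (@slab n `[a, b]%classic c).
Proof.
rewrite (_ : slab _ _ = ((fun t : n.+1.-tuple R => tnth t ord0) @^-1` `[a, b]%classic) `&`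
  \bigcap_(i in [set: 'I_n])
    ((fun t : n.+1.-tuple R => tnth t (lift ord0 i)) @^-1` `[0, c]%classic)).
  apply: measurableI.
    rewrite -[X in measurable X]setTI; exact: measurable_tnth.
  apply: fin_bigcap_measurable => [|i _]; first by [].
  rewrite -[X in measurable X]setTI; exact: measurable_tnth.
apply/seteqP; split => [t [t0 tc]|t [t0 tc]]; split => // i; first by move=> _; exact: tc.
exact: tc i Logic.I.
Qed.

Lemma lebesgueRn_slab n (a b c : R) : a < b -> 0 <= c ->
  mu n.+1 (@slab n `[a, b]%classic c) = ((b - a) * c ^+ n)%:E.
Proof.
move=> ab c0; rewrite (lebesgueRnS_rect _ (@measurable_cube n c) (@consRn_slab _ _ _)).
  by rewrite lebesgue_measure_itv/= lte_fin ab lebesgueRn_cube// EFinM.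
exact: measurable_itv.
Qed.

End box_measure.

Section high_frequency.
Context {R : realType} {n : nat} (w : R -> R) (delta S : R).
Local Notation d := n.+2.
Hypotheses (delta0 : 0 < delta) (W : radial_weight n.+1 w delta S).
Local Notation Q := (S / d%:R).
Implicit Types x y : 'rV[R]_d.

Lemma one_sub_cosD_le (a b : R) :
  1 - cos (a + b) <= 2 * (1 - cos a) + 2 * (1 - cos b).
Proof.
have [p ->] : exists p, a = p *+ 2 by exists (a / 2); rewrite mulr2n -splitr.
have [q ->] : exists q, b = q *+ 2 by exists (b / 2); rewrite mulr2n -splitr.
rewrite -mulrnDl !cos_mulr2n !cos2sin2 sinD.
have := cos2Dsin2 p; have := cos2Dsin2 q.
move: (sin p) (cos p) (sin q) (cos q) => u c v e ev cu.
have c1 : u ^+ 2 * v ^+ 2 >= 0 by rewrite mulr_ge0 ?sqr_ge0.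
have ce : c ^+ 2 = 1 - u ^+ 2 by rewrite -cu; ring.
have ee : e ^+ 2 = 1 - v ^+ 2 by rewrite -ev; ring.
have := sqr_ge0 (u * e - c * v).
have -> : (u * e - c * v) ^+ 2 = 2 * (u ^+ 2 * e ^+ 2 + c ^+ 2 * v ^+ 2) - (u * e + c * v) ^+ 2.
  by ring.
rewrite ce ee; lra.
Qed.

Lemma cos_symbolD_le x y : cos_symbol w (x + y) <= 2 * cos_symbol w x + 2 * cos_symbol w y.
Proof.
have qx := quadratic_bound_cos x; have qy := quadratic_bound_cos y.
have q2x := quadratic_boundZ 2 qx; have q2y := quadratic_boundZ 2 qy.
rewrite -(radial_intZ W 2 qx) -(radial_intZ W 2 qy) -(radial_intD W q2x q2y).
apply: (le_radial_int W); [exact: quadratic_bound_cos|exact: quadratic_boundD|].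
by move=> s _; rewrite dotpDl; exact: one_sub_cosD_le.
Qed.

(** A vector of length at most 2 |x| is the sum of two vectors of length |x|,
    mirror images of each other, on which the radial symbol takes the value
    that it takes at x. This replaces lower bounds on spherical averages. *)
Lemma cos_symbol_le4 x y : enorm y <= 2 * enorm x -> cos_symbol w y <= 4 * cos_symbol w x.
Proof.
move=> yx; set k := enorm x; set r := enorm y / 2.
have r0 : 0 <= r by rewrite divr_ge0// enorm_ge0.
have rk : r <= k by rewrite /r /k ler_pdivrMr// mulrC.
pose h := Num.sqrt (k ^+ 2 - r ^+ 2).
have h2 : h ^+ 2 = k ^+ 2 - r ^+ 2.
  by rewrite sqr_sqrtr// subr_ge0 lerXn2r// nnegrE enorm_ge0.
pose z (h : R) : 'rV[R]_d := r *: e0 n.+1 + h *: delta_mx 0 (lift ord0 ord0).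
have nz h' : h' ^+ 2 = h ^+ 2 -> enorm (z h') = k.
  move=> hh; rewrite /enorm /dotp !big_ord_recl big1 => [|i _].
    rewrite !mxE !eqxx/= !mulr1 !mulr0 !addr0 add0r -!expr2 hh h2 addrC subrK.
    by rewrite sqrtr_sqr ger0_norm// enorm_ge0.
  by rewrite !mxE/= !mulr0 addr0 mulr0.
have dz h' : h' ^+ 2 = h ^+ 2 -> cos_symbol w (z h') = cos_symbol w x.
  by move=> hh; rewrite (cos_symbol_radial W) nz// [RHS](cos_symbol_radial W).
have -> : cos_symbol w y = cos_symbol w (z h + z (- h)).
  rewrite (cos_symbol_radial W); congr cos_symbol.
  by rewrite /z scaleNr addrACA subrr addr0 -scalerDl /r -splitr.
apply: (le_trans (cos_symbolD_le _ _)); rewrite !dz ?sqrrN//; lra.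
Qed.

(** Compare x with a vector of length 1 / delta, where the Taylor bound of
    cos_symbol_ge gives 11/24 of Q / delta^2; a quarter of it is more than a
    ninth. *)
Lemma cos_symbol_ge_high x : 1 <= delta * enorm x -> Q / 9 / delta ^+ 2 <= cos_symbol w x.
Proof.
move=> x1; have Q0 := weight_moment_ge0 W.
have ne : enorm (delta^-1 *: e0 n.+1 : 'rV[R]_d) = delta^-1.
  by rewrite enormZ enorm_e0 mulr1 ger0_norm// invr_ge0 ltW.
have le4 : cos_symbol w (delta^-1 *: e0 n.+1) <= 4 * cos_symbol w x.
  apply: cos_symbol_le4; rewrite ne -(ler_pM2l delta0) mulfV ?gt_eqF// mulrCA.
  by move: x1; lra.
have := cos_symbol_ge delta0 W (delta^-1 *: e0 n.+1).
rewrite ne mulfV ?gt_eqF// expr1n exprVn => ge.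
have : 0 <= Q / delta ^+ 2 by rewrite divr_ge0// sqr_ge0.
move: ge le4; have -> : Q / 9 / delta ^+ 2 = Q / delta ^+ 2 / 9 by ring.
have -> : Q / 2 / delta ^+ 2 = Q / delta ^+ 2 / 2 by ring.
by move: (Q / delta ^+ 2) (cos_symbol w _) (cos_symbol w x) => q y z; lra.
Qed.

(** On the box where the first coordinate lies in [1/4k, 1/2k] and the others
    in [0, 1/2k], with k = |x|, the integrand is at least c / 33. The box lies
    in the open ball of radius 1/k because the dimension is at most 3. *)
Lemma cos_symbol_ge_box x c : (n <= 1)%N -> 0 < enorm x -> 0 <= c ->
  (forall r, 0 < r < (enorm x)^-1 -> c <= w r) ->
  c / enorm x ^+ d / 4 / 2 ^+ n.+1 / 33 <= cos_symbol w x.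
Proof.
move=> n1; set k := enorm x => k0 c0 cw.
pose B := @slab R n.+1 `[(4 * k)^-1, (2 * k)^-1]%classic (2 * k)^-1.
have iW := radial_int_integrable W (quadratic_bound_cos (k *: e0 n.+1 : 'rV[R]_d)).
rewrite (cos_symbol_radial W) -/k -lee_fin /cos_symbol /radial_int fineK; last first.
  exact: integrable_fin_num iW.
have F0 (t : d.-tuple R) : 0 <= w (enorm (row_of_tuple t)) *
    (1 - cos (dotp (k *: e0 n.+1) (row_of_tuple t))).
  by rewrite mulr_ge0 ?subr_ge0 ?cos_le1// (weight_ge0 W)// enorm_ge0.
have mF := measurable_int _ iW.
have mBE : lebesgueRn R d B = (((2 * k)^-1 - (4 * k)^-1) * (2 * k)^-1 ^+ n.+1)%:E.
  apply: lebesgueRn_slab; last by rewrite invr_ge0 mulr_ge0// ltW.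
  by rewrite ltf_pV2 ?posrE ?mulr_gt0// ltr_pM2r// ltr_nat.
have mB : measurable B by exact: measurable_slab.
apply: (@le_trans _ _ (\int[lebesgueRn R d]_(t in B) (c / 33)%:E)%E).
  rewrite integral_cst// [X in (_ * X)%E]mBE -EFinM lee_fin le_eqVlt.
  apply/orP; left; apply/eqP; rewrite !exprS !exprVn exprMn; field.
  by rewrite !expf_neq0 ?gt_eqF.
apply: (@le_trans _ _ (\int[lebesgueRn R d]_(t in B)
  (w (enorm (row_of_tuple t)) * (1 - cos (dotp (k *: e0 n.+1) (row_of_tuple t))))%:E)%E); last first.
  by apply: ge0_subset_integral => // t _; rewrite lee_fin.
apply: ge0_le_integral => //.
- by move=> t _; rewrite lee_fin divr_ge0.
- exact: measurable_funS mF.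
move=> t [] /=; rewrite in_itv/= => /andP[t1 t2] tc.
rewrite lee_fin ler_pM//.
  have T1 i : 0 <= tnth t i <= (2 * k)^-1.
    case: (unliftP ord0 i) => [j|] ->; first by move: (tc j); rewrite in_itv.
    by rewrite t2 andbT (le_trans _ t1)// invr_ge0 mulr_ge0// ltW.
  apply: cw; apply/andP; split.
    rewrite sqrtr_gt0 /dotp big_ord_recl ltr_pwDl//.
      rewrite mxE mulr_gt0// (lt_le_trans _ t1)// invr_gt0 mulr_gt0//.
    by apply: sumr_ge0 => i _; rewrite -expr2 sqr_ge0.
  rewrite -ltr_sqr ?nnegrE ?enorm_ge0 ?invr_ge0 ?ltW// sqr_enorm.
  apply: (@le_lt_trans _ _ (\sum_(i < d) (2 * k)^-1 ^+ 2)).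
    apply: ler_sum => i _; rewrite mxE -expr2.
    have /andP[i0 i1] := T1 i.
    by rewrite lerXn2r// nnegrE invr_ge0 mulr_ge0// ltW.
  rewrite sumr_const card_ord -[ltLHS]mulr_natl !exprVn exprMn invfM mulrA.
  rewrite gtr_pMl ?invr_gt0 ?exprn_gt0//.
  rewrite ltr_pdivrMr// mul1r -natrX ltr_nat.
  by case: (n) n1 => [|[]].
rewrite dotpZl dotp_delta mxE; set u := k * _.
have u1 : 4^-1 <= u.
  by move: t1; rewrite invfM mulrC ler_pdivrMl.
have u2 : u <= 2^-1.
  by move: t2; rewrite invfM mulrC ler_pdivlMl.
apply: le_trans (one_sub_cos_ge _).
have v1 : 16^-1 <= u ^+ 2 by nra.
have v2 : u ^+ 2 <= 4^-1 by nra.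
have -> : u ^+ 4 = u ^+ 2 * u ^+ 2 by ring.
have : u ^+ 2 * u ^+ 2 <= 4^-1 * u ^+ 2 by rewrite ler_wpM2r ?sqr_ge0.
by move: (u ^+ 2) v1 => v; lra.
Qed.

End high_frequency.

(** * Errors of the symbols of the solution operators *)

Section symbol_errors.
Context {R : realType}.
Variables (m M K : R).
Hypotheses (m0 : 0 < m) (M0 : 0 < M) (K0 : 0 < K).

(** The sum of the constants that occur in the eight bounds below. *)
Definition symbol_const : R :=
  4 * (1 + M) + 1 + K^-1 + 27 / m + Num.sqrt (27 / (m * K)).

Lemma symbol_const_ge : [/\ 4 * (1 + M) <= symbol_const, 1 + K^-1 <= symbol_const,
  1 + 27 / m <= symbol_const & 1 + Num.sqrt (27 / (m * K)) <= symbol_const].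
Proof.
have K1 : 0 <= K^-1 by rewrite invr_ge0 ltW.
have m1 : 0 <= 27 / m by rewrite divr_ge0// ltW.
have s1 : 0 <= Num.sqrt (27 / (m * K)) by rewrite sqrtr_ge0.
rewrite /symbol_const; split; move: m1 K1 s1 (ltW M0); move: (27 / m) (K^-1) (Num.sqrt _) => u v t; lra.
Qed.

Section fixed_frequency.
Variables (delta k lam c beta : R).
Hypotheses (delta0 : 0 < delta) (k0 : 0 < k).
Hypotheses (lam_le : lam <= k ^+ 2)
  (lam_ge : k ^+ 2 * (1 - (delta * k) ^+ 2 / 12) <= lam)
  (c0 : 0 <= c) (c_le : c <= M * k ^+ 2)
  (beta_le : beta <= k) (beta_ge : k * (1 - (delta * k) ^+ 2 / 6) <= beta).
Local Notation x := (delta * k).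
Local Notation D := (lam * (delta ^+ 2 * c) + beta ^+ 2).

(** Here lambda, beta^2 and D all equal k^2 up to a relative error O(x^2). *)
Lemma symbol_error_low : x <= 1 ->
  [/\ 0 < lam /\ 0 < D,
      `|k ^- 2 - lam^-1| <= symbol_const * delta ^+ 2,
      `|delta ^+ 2 * c / D| <= symbol_const * delta ^+ 2,
      `|k^-1 - beta / D| <= symbol_const * (delta ^+ 2 * k) &
      `|1 - lam / D| <= symbol_const * x ^+ 2].
Proof.
move=> x1; have [C1 C2 C3 C4] := symbol_const_ge.
have x0 : 0 < x by rewrite mulr_gt0.
have x2 : x ^+ 2 <= 1 by rewrite exprn_ile1// ltW.
have k2 : 0 < k ^+ 2 by rewrite exprn_gt0.
have d2 : 0 < delta ^+ 2 by rewrite exprn_gt0.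
have k2x : k ^+ 2 * x ^+ 2 <= k ^+ 2 by rewrite ler_piMr// ltW.
have k1x : k * x ^+ 2 <= k by rewrite ler_piMr// ltW.
have lam1 : 11 / 12 * k ^+ 2 <= lam by apply: le_trans lam_ge; move: k2x; lra.
have lam0 : 0 < lam by apply: lt_le_trans lam1; rewrite mulr_gt0.
have beta1 : 5 / 6 * k <= beta by apply: le_trans beta_ge; move: k1x; lra.
have beta0 : 0 < beta by apply: lt_le_trans beta1; rewrite mulr_gt0.
have lc0 : 0 <= lam * (delta ^+ 2 * c) by rewrite !mulr_ge0// ltW.
have lc1 : lam * (delta ^+ 2 * c) <= M * x ^+ 2 * k ^+ 2.
  have -> : M * x ^+ 2 * k ^+ 2 = k ^+ 2 * (delta ^+ 2 * (M * k ^+ 2)) by ring.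
  apply: ler_pM => //; first exact: ltW.
    by rewrite mulr_ge0// ltW.
  by rewrite ler_wpM2l// ltW.
have beta2 : beta ^+ 2 <= k ^+ 2 by rewrite lerXn2r// nnegrE ltW.
have beta3 : k ^+ 2 * (1 - x ^+ 2 / 3) <= beta ^+ 2.
  have : (k * (1 - x ^+ 2 / 6)) ^+ 2 <= beta ^+ 2.
    rewrite lerXn2r// ?nnegrE ?(ltW beta0)// mulr_ge0 ?ltW//.
    by move: (x ^+ 2) x2 => z; lra.
  apply: le_trans; rewrite [leRHS]exprMn ler_wpM2l ?(ltW k2)//.
  by move: (x ^+ 2) => z; rewrite -subr_ge0; nra.
have D1 : 2^-1 * k ^+ 2 <= D.
  have : (5 / 6 * k) ^+ 2 <= beta ^+ 2.
    by rewrite lerXn2r// nnegrE ?mulr_ge0// ltW.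
  by move: lc0 k2; lra.
have D0 : 0 < D by apply: lt_le_trans D1; rewrite mulr_gt0.
have Dle a b : 0 <= b -> `|a| <= b * (2^-1 * k ^+ 2) -> `|a / D| <= b.
  move=> b0 ab; rewrite normrM normfV (gtr0_norm D0) ler_pdivrMr//.
  by apply: (le_trans ab); rewrite ler_wpM2l.
have C0 : 0 <= symbol_const by apply: le_trans C1; rewrite mulr_ge0// addr_ge0// ltW.
split => //.
- have -> : k ^- 2 - lam^-1 = (lam - k ^+ 2) / (k ^+ 2 * lam).
    by field; rewrite !gt_eqF.
  rewrite normrM normfV (gtr0_norm (mulr_gt0 k2 lam0)) ler_pdivrMr ?mulr_gt0//.
  rewrite ler0_norm ?subr_le0// opprB.
  apply: (@le_trans _ _ (1 * (k ^+ 2 * (x ^+ 2 / 12)))).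
    by move: lam_ge; rewrite mulrBr mulr1; lra.
  have -> : symbol_const * delta ^+ 2 * (k ^+ 2 * lam) = symbol_const * (x ^+ 2 * lam).
    by ring.
  apply: ler_pM => //; first by rewrite mulr_ge0 ?(ltW k2)// divr_ge0// sqr_ge0.
    by move: M0 C1; lra.
  have -> : k ^+ 2 * (x ^+ 2 / 12) = x ^+ 2 * (k ^+ 2 / 12) by ring.
  rewrite ler_wpM2l ?sqr_ge0//; move: k2 lam1; lra.
- apply: Dle; first by rewrite mulr_ge0// ltW.
  rewrite (ger0_norm (mulr_ge0 (ltW d2) c0)).
  have -> : symbol_const * delta ^+ 2 * (2^-1 * k ^+ 2) =
    delta ^+ 2 * (symbol_const / 2 * k ^+ 2) by ring.
  rewrite ler_wpM2l ?(ltW d2)// (le_trans c_le)// ler_wpM2r ?(ltW k2)//.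
  by move: M0 C1; lra.
- have -> : k^-1 - beta / D = ((D - beta * k) / k) / D.
    by field; rewrite !gt_eqF.
  apply: Dle; first by rewrite !mulr_ge0// ltW.
  rewrite normrM normfV (gtr0_norm k0) ler_pdivrMr//.
  have -> : symbol_const * (delta ^+ 2 * k) * (2^-1 * k ^+ 2) * k =
    symbol_const / 2 * x ^+ 2 * k ^+ 2 by ring.
  apply: (@le_trans _ _ ((1 + M) * x ^+ 2 * k ^+ 2)); last first.
    rewrite ler_wpM2r ?(ltW k2)// ler_wpM2r ?sqr_ge0//.
    by move: M0 C1; lra.
  have bk : beta * (k - beta) <= x ^+ 2 * k ^+ 2.
    have -> : x ^+ 2 * k ^+ 2 = k * (k * x ^+ 2) by ring.
    apply: ler_pM; rewrite ?(ltW beta0) ?subr_ge0//.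
    have : 0 <= k * x ^+ 2 by rewrite mulr_ge0 ?sqr_ge0// ltW.
    by move: beta_ge; rewrite mulrBr mulr1; lra.
  have bk0 : 0 <= beta * (k - beta) by rewrite mulr_ge0 ?subr_ge0// ltW.
  by rewrite ler_norml; apply/andP; split; move: bk bk0 lc0 lc1; lra.
- have -> : 1 - lam / D = (D - lam) / D by field; rewrite !gt_eqF.
  apply: Dle; first by rewrite mulr_ge0 ?sqr_ge0.
  apply: (@le_trans _ _ ((1 + M) * x ^+ 2 * k ^+ 2)); last first.
    have -> : symbol_const * x ^+ 2 * (2^-1 * k ^+ 2) =
      symbol_const / 2 * x ^+ 2 * k ^+ 2 by ring.
    rewrite ler_wpM2r ?(ltW k2)// ler_wpM2r ?sqr_ge0//.
    by move: M0 C1; lra.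
  have xk : 0 <= x ^+ 2 * k ^+ 2 by rewrite mulr_ge0 ?sqr_ge0.
  have b3 : k ^+ 2 - x ^+ 2 * k ^+ 2 / 3 <= beta ^+ 2.
    by apply: le_trans beta3; rewrite le_eqVlt; apply/orP; left; apply/eqP; ring.
  have l3 : k ^+ 2 - x ^+ 2 * k ^+ 2 / 12 <= lam.
    by apply: le_trans lam_ge; rewrite le_eqVlt; apply/orP; left; apply/eqP; ring.
  move: lc1; have -> : M * x ^+ 2 * k ^+ 2 = M * (x ^+ 2 * k ^+ 2) by ring.
  have -> : (1 + M) * x ^+ 2 * k ^+ 2 = x ^+ 2 * k ^+ 2 + M * (x ^+ 2 * k ^+ 2) by ring.
  move: xk b3 l3 lc0 beta2 lam_le.
  move: (x ^+ 2 * k ^+ 2) => q.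
  move: (lam * (delta ^+ 2 * c)) (beta ^+ 2) (k ^+ 2) => p r t xk b3 l3 p0 rt lt pM.
  have Mq : 0 <= M * q by exact: le_trans p0 pM.
  by rewrite ler_norml; apply/andP; split; move: (M * q) Mq pM => z; lra.
Qed.

(** There is no lower bound on beta at these frequencies; beta^2 <= D and
    D >= (m / 27) lambda suffice. In the applications y = x^alpha. *)
Lemma symbol_error_high y : 1 <= y <= x ->
  m / 27 / delta ^+ 2 <= c -> K * y ^+ 2 / delta ^+ 2 <= lam ->
  [/\ 0 < lam /\ 0 < D,
      `|k ^- 2 - lam^-1| <= symbol_const * (delta ^+ 2 / y ^+ 2),
      `|delta ^+ 2 * c / D| <= symbol_const * (delta ^+ 2 / y ^+ 2),
      `|k^-1 - beta / D| <= symbol_const * (delta / y) &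
      `|1 - lam / D| <= symbol_const].
Proof.
move=> /andP[y1 yx] cge lge; have [C1 C2 C3 C4] := symbol_const_ge.
have y0 : 0 < y by exact: lt_le_trans y1.
have y2 : 0 < y ^+ 2 by rewrite exprn_gt0.
have d2 : 0 < delta ^+ 2 by rewrite exprn_gt0.
have lam0 : 0 < lam by apply: lt_le_trans lge; rewrite divr_gt0// mulr_gt0.
have dc : m / 27 <= delta ^+ 2 * c by rewrite [leRHS]mulrC -ler_pdivrMr.
have m27 : 0 < m / 27 by rewrite divr_gt0.
have lc : lam * (m / 27) <= lam * (delta ^+ 2 * c) by rewrite ler_pM2l.
have D1 : lam * (m / 27) <= D by rewrite (le_trans lc)// lerDl sqr_ge0.
have D0 : 0 < D by apply: lt_le_trans D1; rewrite mulr_gt0.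
have Vlam : lam^-1 <= K^-1 * (delta ^+ 2 / y ^+ 2).
  rewrite -[leRHS]invrK lef_pV2 ?posrE// ?invr_gt0 ?mulr_gt0 ?invr_gt0//.
  apply: le_trans lge; rewrite le_eqVlt; apply/orP; left; apply/eqP; field.
  by rewrite !gt_eqF.
have Vk : k^-1 <= delta / y.
  by rewrite ler_pdivlMr// mulrC ler_pdivrMr.
have dy : 0 <= delta / y by rewrite divr_ge0// ltW.
have dy2 : 0 <= delta ^+ 2 / y ^+ 2 by rewrite divr_ge0// ltW.
have Vk0 : 0 <= k^-1 by rewrite invr_ge0 ltW.
have Vlam0 : 0 <= lam^-1 by rewrite invr_ge0 ltW.
split => //.
- apply: (le_trans (ler_normB _ _)).
  rewrite !ger0_norm ?invr_ge0 ?sqr_ge0// ?(ltW lam0)//.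
  apply: (@le_trans _ _ ((1 + K^-1) * (delta ^+ 2 / y ^+ 2))); last exact: ler_wpM2r.
  rewrite mulrDl mul1r lerD// -exprVn -expr_div_n lerXn2r// nnegrE.
- have A3 : delta ^+ 2 * c / D <= lam^-1.
    rewrite ler_pdivrMr// mulrDr mulKf ?gt_eqF// lerDl.
    by rewrite mulr_ge0// sqr_ge0.
  rewrite ger0_norm; last by rewrite divr_ge0 ?(ltW D0)// mulr_ge0// ltW.
  apply: (le_trans A3); apply: (le_trans Vlam); rewrite ler_wpM2r//.
  by apply: le_trans C2; rewrite lerDr.
- apply: (le_trans (ler_normB _ _)); rewrite (ger0_norm Vk0).
  apply: (@le_trans _ _ ((1 + Num.sqrt (27 / (m * K))) * (delta / y))); last exact: ler_wpM2r.
  rewrite mulrDl mul1r lerD//.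
  have s0 : 0 <= 27 / (m * K) by rewrite divr_ge0// mulr_ge0// ltW.
  have r0 : 0 <= Num.sqrt (27 / (m * K)) * (delta / y) by rewrite mulr_ge0 ?sqrtr_ge0.
  rewrite -ler_sqr ?nnegrE// exprMn sqr_sqrtr//.
  rewrite real_normK ?num_real// !expr_div_n.
  (* (beta / D)^2 <= 1 / D *)
  apply: (@le_trans _ _ D^-1).
    rewrite ler_pdivrMr ?exprn_gt0// expr2 mulKf ?gt_eqF// lerDr.
    by rewrite mulr_ge0 ?(ltW lam0)// (le_trans (ltW m27)).
  apply: (@le_trans _ _ (lam * (m / 27))^-1).
    by rewrite lef_pV2// posrE mulr_gt0.
  rewrite invfM invf_div.
  apply: (@le_trans _ _ (K^-1 * (delta ^+ 2 / y ^+ 2) * (27 / m))).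
    by rewrite ler_wpM2r// divr_ge0// ltW.
  by rewrite le_eqVlt; apply/orP; left; apply/eqP; field; rewrite !gt_eqF.
- apply: (le_trans (ler_normB _ _)); rewrite normr1.
  apply: le_trans C3; rewrite lerD2l ger0_norm ?divr_ge0 ?(ltW D0) ?(ltW lam0)//.
  rewrite ler_pdivrMr//.
  apply: (@le_trans _ _ (27 / m * (lam * (m / 27)))).
    by rewrite le_eqVlt; apply/orP; left; apply/eqP; field; rewrite gt_eqF.
  by rewrite ler_wpM2l// divr_ge0// ltW.
Qed.

End fixed_frequency.
End symbol_errors.

(** * Powers of delta and of the frequency *)

Section power_weights.
Context {R : realType}.
Variables (delta k alpha : R).
Hypotheses (delta01 : 0 < delta < 1) (k1 : 1 <= k) (alpha01 : 0 <= alpha <= 1).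
Local Notation x := (delta * k).
Local Notation y := (x `^ alpha).

Let delta0 : 0 < delta. Proof. by case/andP: delta01. Qed.
Let k0 : 0 < k. Proof. exact: lt_le_trans k1. Qed.
(** All inequalities below compare monomials in delta and k; taking logarithms
    makes them polynomial in alpha, eta, beta, - ln delta >= 0 and ln k >= 0. *)
Let deltaE s : delta `^ s = expR (- (- ln delta * s)).
Proof. by rewrite /powR gt_eqF// mulNr opprK mulrC. Qed.
Let kE s : k `^ s = expR (ln k * s).
Proof. by rewrite /powR gt_eqF// mulrC. Qed.
Let yE : y = expR ((ln k - - ln delta) * alpha).
Proof. by rewrite /powR gt_eqF ?mulr_gt0// lnM ?posrE// mulrC opprK addrC. Qed.
Let d1 : delta = delta `^ 1. Proof. by rewrite powRr1// ltW. Qed.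
Let dV z : delta / z = delta `^ 1 / z. Proof. by rewrite -d1. Qed.
Let ge1E z : (1 <= expR z :> R) = (0 <= z). Proof. by rewrite -[X in X <= _]expR0 ler_expR. Qed.
Let d2 : delta ^+ 2 = delta `^ 2. Proof. by rewrite powR_mulrn// ltW. Qed.
Let kk : k = k `^ 1. Proof. by rewrite powRr1// ltW. Qed.
Let y2 : y ^+ 2 = expR ((ln k - - ln delta) * alpha * 2).
Proof. by rewrite yE -expRM_natr. Qed.
Let b0 : 0 <= ln k. Proof. exact: ln_ge0. Qed.
Let a0 : 0 <= - ln delta.
Proof. by rewrite oppr_ge0 ln_le0//; case/andP: delta01 => _ /ltW. Qed.
Let xE : x = expR (ln k - - ln delta).
Proof. by rewrite opprK expRD !lnK// mulrC. Qed.
Let xle1 : (x <= 1) = (ln k <= - ln delta).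
Proof. by rewrite xE -[X in _ <= X]expR0 ler_expR subr_le0. Qed.
Let xge1 : (1 <= x) = (- ln delta <= ln k).
Proof. by rewrite xE -[X in X <= _]expR0 ler_expR subr_ge0. Qed.

Lemma power_weight_y : 1 <= x -> 1 <= y <= x.
Proof.
case/andP: alpha01 => al0 al1 x1; apply/andP; split.
  by rewrite -[leLHS](powRr0 x) ler_powR.
by rewrite -[leRHS]powRr1 ?(le_trans _ x1)// ler_powR.
Qed.

Variables (eta beta : R).
Hypotheses (eta01 : 0 <= eta <= 1) (beta02 : 0 <= beta <= 2).

(** The left-hand sides are the error bounds of symbol_error_low, the first two
    multiplied by the weight k^alpha of the velocity norm; the right-hand sides
    are the rates of the theorem times the weights of the data norms.
    power_weights_high does the same for symbol_error_high. *)
Lemma power_weights_low : x <= 1 ->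
  [/\ k `^ alpha * delta ^+ 2 <=
        delta `^ Num.min 2 (2 - 2 * alpha + eta) * k `^ (eta - alpha),
      k `^ alpha * (delta ^+ 2 * k) <=
        delta `^ Num.min 2 (1 - alpha + beta) * k `^ beta,
      delta ^+ 2 * k <= delta `^ (1 - alpha + eta) * k `^ (eta - alpha) &
      x ^+ 2 <= delta `^ beta * k `^ beta].
Proof.
case/andP: alpha01 => al0 al1; case/andP: eta01 => e0 e1; case/andP: beta02 => be0 be2.
rewrite xle1 xE -expRM_natr d2 [X in delta `^ 2 * X]kk !deltaE !kE -!expRD !ler_expR.
move: (ln k) (- ln delta) b0 a0 => b a pb pa ba.
by split; rewrite ?minElt; try case: ltP => h; nra.
Qed.

Lemma power_weights_high : 1 <= x ->
  [/\ k `^ alpha * (delta ^+ 2 / y ^+ 2) <=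
        delta `^ Num.min 2 (2 - 2 * alpha + eta) * k `^ (eta - alpha),
      k `^ alpha * (delta / y) <=
        delta `^ Num.min 2 (1 - alpha + beta) * k `^ beta,
      delta / y <= delta `^ (1 - alpha + eta) * k `^ (eta - alpha) &
      1 <= delta `^ beta * k `^ beta].
Proof.
case/andP: alpha01 => al0 al1; case/andP: eta01 => e0 e1; case/andP: beta02 => be0 be2.
rewrite xge1 y2 yE d2 (dV (expR _)) !deltaE !kE -!expRN -!expRD ge1E !ler_expR.
move: (ln k) (- ln delta) b0 a0 => b a pb pa ba.
by split; rewrite ?minElt; try case: ltP => h; nra.
Qed.

End power_weights.

(** * Saddle-point systems *)

Section saddle_point.
Context {R : realType} {d : nat}.
Local Open Scope complex_scope.
Implicit Types (U F e : 'cV[R[i]]_d).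

Lemma saddle_mx_components a (b : 'cV[R]_d) c U P F (G : R[i]) :
  saddle_mx a b c *m col_mx U P%:M = col_mx F G%:M ->
  (forall j, a%:C * U j 0 + 'i%C * (b j 0)%:C * P = F j 0) /\
  'i%C * (\sum_j (b j 0)%:C * U j 0) + c%:C * P = G.
Proof.
rewrite /saddle_mx mul_block_col => /eq_col_mx[E1 E2]; split.
  move=> j; have := congr1 (fun X : 'cV[R[i]]_d => X j 0) E1.
  by rewrite mul_scalar_mx mul_mx_scalar !mxE [P * _]mulrC.
have := congr1 (fun X : 'M[R[i]]_1 => X 0 0) E2.
rewrite mul_scalar_mx -scalemxAl !mxE !eqxx !mulr1n => <-.
by congr (_ * _ + _); apply: eq_bigr => j _; rewrite !mxE.
Qed.

(** Elimination in the plane spanned by e: the component of U along e and P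
    solve a 2 by 2 system of determinant D, and the part of U orthogonal to e
    is that of F divided by a. *)
Lemma saddle_solution a beta c (e : 'cV[R]_d) U P F (G : R[i]) :
  \sum_j e j 0 ^+ 2 = 1 -> a != 0 -> a * c + beta ^+ 2 != 0 ->
  saddle_mx a (beta *: e) c *m col_mx U P%:M = col_mx F G%:M ->
  let D := a * c + beta ^+ 2 in
  let Fpar := \sum_j (e j 0)%:C * F j 0 in
  P = (a / D)%:C * G - 'i%C * (beta / D)%:C * Fpar /\
  forall j, U j 0 = (a^-1)%:C * (F j 0 - (e j 0)%:C * Fpar) +
     (e j 0)%:C * ((c / D)%:C * Fpar - 'i%C * (beta / D)%:C * G).
Proof.
move=> e1 a0 D0 /saddle_mx_components[E1 E2] D Fpar.
have i2 : 'i%C * 'i%C = (-1 : R[i]) by rewrite -expr2 sqr_i.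
pose Upar := \sum_j (e j 0)%:C * U j 0.
have EG : 'i%C * beta%:C * Upar + c%:C * P = G.
  rewrite -E2 -mulrA; congr (_ * _ + _); rewrite mulr_sumr.
  by apply: eq_bigr => j _; rewrite mxE rmorphM/= mulrA.
have EF : a%:C * Upar + 'i%C * beta%:C * P = Fpar.
  rewrite /Fpar; under eq_bigr do rewrite -E1 mxE.
  transitivity (\sum_j (a%:C * ((e j 0)%:C * U j 0) + 'i%C * beta%:C * P * (e j 0 ^+ 2)%:C)).
    rewrite big_split/= -!mulr_sumr -[in RHS]rmorph_sum/= e1 mulr1.
    by [].
  apply: eq_bigr => j _; rewrite rmorphXn rmorphM/=; ring.
have aC : a%:C != 0 by rewrite (fmorph_eq0 (real_complex R)).
have DC : D%:C != 0 by rewrite (fmorph_eq0 (real_complex R)).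
have PD : D%:C * P = a%:C * G - 'i%C * beta%:C * Fpar.
  rewrite -EG -EF rmorphD rmorphM rmorphXn/=.
  transitivity (a%:C * c%:C * P - ('i%C * 'i%C) * beta%:C ^+ 2 * P); last by ring.
  by rewrite i2; ring.
have PE : P = (a / D)%:C * G - 'i%C * (beta / D)%:C * Fpar.
  apply: (mulfI DC); rewrite PD !rmorphM !fmorphV/=; field; exact: DC.
split=> // j; apply: (mulfI aC).
transitivity (F j 0 - 'i%C * (beta * e j 0)%:C * P).
  by rewrite -E1 mxE; ring.
rewrite PE !rmorphM !fmorphV/=.
transitivity (F j 0 - (e j 0)%:C * ('i%C * beta%:C * (a%:C / D%:C) * G) +
   ('i%C * 'i%C) * (e j 0)%:C * beta%:C ^+ 2 / D%:C * Fpar); first by field; exact: DC.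
have bD : beta%:C ^+ 2 = D%:C - a%:C * c%:C.
  by rewrite rmorphD rmorphM rmorphXn/=; ring.
by rewrite i2 bD; field; rewrite aC DC.
Qed.

End saddle_point.

(** * The kernels of the nonlocal system *)

Section kernel_symbols.
Context {R : realType}.

(** The inverse agrees with the real power of exponent -1 on nonnegative
    arguments. *)
Lemma measurable_inv_nneg : measurable_fun (`[0, +oo[%classic : set R) (@GRing.inv R).
Proof.
apply: (eq_measurable_fun (@powR R ^~ (-1))).
  by move=> r; rewrite inE/= in_itv/= andbT => r0; rewrite powR_inv1.
by apply: measurable_funTS; exact: measurable_powR.
Qed.

Section rescaling.
Variables (j : nat) (delta : R) (w : R -> R).
Hypotheses (delta0 : 0 < delta) (uw : unit_kernel w).

Lemma measurable_rescale :
  measurable_fun (`[0, +oo[%classic : set R) (rescale j delta w).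
Proof.
case: uw => mw _ _; apply: measurable_funM => //.
apply: (measurable_comp _ _ mw) => //.
- move=> _ [r r0 <-]; move: r0; rewrite /= !in_itv/= !andbT => r0.
  by rewrite divr_ge0 ?(ltW delta0).
- exact: measurable_funM.
Qed.

Lemma rescale_ge0 r : 0 <= r -> 0 <= rescale j delta w r.
Proof.
case: uw => _ w0 _ r0; rewrite /rescale mulr_ge0 ?invr_ge0 ?exprn_ge0 ?(ltW delta0)//.
by rewrite w0// divr_ge0// ltW.
Qed.

Lemma rescale_supp r : delta < r -> rescale j delta w r = 0.
Proof.
by case: uw => _ _ w1 dr; rewrite /rescale w1 ?mulr0// ltr_pdivlMr// mul1r.
Qed.

Lemma rescale_radial_weight n S : moment n.+1 2 (rescale j delta w) = S%:E ->
  radial_weight n (rescale j delta w) delta S.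
Proof.
by split => //; [exact: measurable_rescale|exact: rescale_ge0|exact: rescale_supp].
Qed.

(** Dividing a kernel by r turns its first moment into a second moment; at r = 0
    both integrands vanish. *)
Lemma rescale_div_radial_weight n S : moment n.+1 1 (rescale j delta w) = S%:E ->
  radial_weight n (fun r => rescale j delta w r / r) delta S.
Proof.
move=> momE; split.
- by apply: measurable_funM; [exact: measurable_rescale|exact: measurable_inv_nneg].
- by move=> r r0; rewrite divr_ge0// rescale_ge0.
- by move=> r dr; rewrite rescale_supp// mul0r.
rewrite -momE; apply: eq_integral => t _ /=; congr EFin; rewrite expr1 expr2 mulrA.
have [->|r0] := eqVneq (enorm (row_of_tuple t)) 0; first by rewrite !mulr0.
by rewrite divfK.
Qed.

End rescaling.

Lemma Rintegral_ballR n (delta : R) (F : n.-tuple R -> R) :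
  (forall t, delta < enorm (row_of_tuple t) -> F t = 0) ->
  \int[lebesgueRn R n]_(t in @ballR R n delta) F t = \int[lebesgueRn R n]_t F t.
Proof.
move=> F0; rewrite Rintegral_mkcond; apply: eq_Rintegral => t _.
rewrite patchE; case: ifPn => // /negP tB; rewrite F0// ltNge; apply/negP => td.
by apply: tB; rewrite inE.
Qed.

Lemma diffusion_symbolE n delta (w : R -> R) (xi : 'rV[int]_n.+1) :
  (forall r, delta < r -> w r = 0) ->
  diffusion_symbol delta w xi = cos_symbol w (freq R xi).
Proof. by move=> w0; apply: Rintegral_ballR => t dt /=; rewrite w0// mul0r. Qed.

Lemma gradient_symbolE n delta (w : R -> R) (xi : 'rV[int]_n.+1) i :
  (forall r, delta < r -> w r = 0) ->
  gradient_symbol delta w xi i 0 =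
    sin_symbol (fun r => w r / r) (delta_mx 0 i) (freq R xi).
Proof.
move=> w0; rewrite mxE Rintegral_ballR => [|t dt /=]; last by rewrite w0// !mul0r.
by apply: eq_Rintegral => t _ /=; rewrite dotp_delta -!mulrA; congr (_ * _); ring.
Qed.

(** The norms involve nonzero frequencies only, so powers of the frequency are
    monotone in the exponent. *)
Lemma enorm_freq_ge1 n (xi : 'rV[int]_n) : xi != 0 -> 1 <= enorm (freq R xi).
Proof.
move=> xi0; rewrite -[X in X <= _]sqrtr1 ler_sqrt ?dotp_ge0//.
have [i xii] : exists i, xi 0 i != 0.
  by apply/existsP; rewrite -[[exists _, _]]negbK negb_exists; apply: contra xi0
    => /forallP h; apply/eqP/rowP => i; rewrite mxE; apply/eqP; move: (h i); rewrite negbK.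
rewrite /dotp (bigD1 i)//= mxE -expr2 -rmorphXn/=.
apply: (@le_trans _ _ (xi 0 i ^+ 2)%:~R); last first.
  by rewrite lerDl; apply: sumr_ge0 => j _; rewrite mxE -expr2 sqr_ge0.
by rewrite ler1z -gtz0_ge1 exprn_even_gt0.
Qed.

End kernel_symbols.

Section kernel_bounds.
Context {R : realType} {n : nat}.
Local Notation d := n.+2.
Variables (m M delta : R) (om omt omh : R -> R).
Hypotheses (n1 : (n <= 1)%N) (delta01 : 0 < delta < 1).
Hypothesis (KA : kernel_assumption d m M delta om omt omh).
Hypotheses (m0 : 0 < m) (mM : m < M).
Local Notation omd := (rescale (d + 2) delta om).
Local Notation omtd := (rescale (d + 2) delta omt).
Local Notation omhd := (rescale (d + 1) delta omh).

Let delta0 : 0 < delta. Proof. by case/andP: delta01. Qed.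
Let d0 : (d%:R : R) != 0. Proof. by rewrite pnatr_eq0. Qed.
Let dle3 : d%:R <= 3 :> R. Proof. by rewrite ler_nat; case: (n) n1 => [|[]]. Qed.
Let dge1 : 1 <= d%:R :> R. Proof. by rewrite ler1n. Qed.

Lemma omd_weight : radial_weight n.+1 omd delta (2 * d%:R).
Proof.
have [[uo _ _] Ho _ _] := KA; apply: rescale_radial_weight => //.
rewrite EFinM -Ho muleA -EFinM divff ?pnatr_eq0// mul1e//.
Qed.

Lemma omhd_weight : radial_weight n.+1 (fun r => omhd r / r) delta d%:R.
Proof. by have [[_ _ uo] _ Ho _] := KA; apply: rescale_div_radial_weight. Qed.

Lemma omtd_weight : exists2 S, m <= S <= M & radial_weight n.+1 omtd delta S.
Proof.
have [[_ uo _] _ _ /andP[Hm HM]] := KA.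
have fM : moment d 2 omtd \is a fin_num.
  rewrite ge0_fin_numE ?(le_trans _ Hm) ?lee_fin ?(ltW m0)//.
  by rewrite (le_lt_trans HM)// ltry.
exists (fine (moment d 2 omtd)).
  by rewrite -!lee_fin fineK// Hm HM.
by apply: rescale_radial_weight => //; rewrite fineK.
Qed.

Variables (xi : 'rV[int]_d).
Hypothesis xi0 : xi != 0.
Local Notation k := (enorm (freq R xi)).
Local Notation lam := (diffusion_symbol delta omd xi).
Local Notation c := (diffusion_symbol delta omtd xi).
Definition direction : 'cV[R]_d := \col_i (freq R xi 0 i / k).
(** The number beta with b_delta(xi) = beta xi / |xi|; it may be negative or
    zero at high frequency. *)
Definition gradient_factor := radial_sin_symbol (n := n.+1) (fun r => omhd r / r) k.

Let k1 : 1 <= k. Proof. exact: enorm_freq_ge1. Qed.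
Let k0 : 0 < k. Proof. exact: lt_le_trans k1. Qed.

Lemma freq_neq0 : freq R xi != 0.
Proof.
apply: contraTneq k0 => ->; rewrite /enorm /dotp big1 ?sqrtr0 ?ltxx// => i _.
by rewrite mxE mul0r.
Qed.

Lemma direction_unit : \sum_j direction j 0 ^+ 2 = 1.
Proof.
under eq_bigr do rewrite mxE expr_div_n.
rewrite -mulr_suml.
have -> : \sum_j freq R xi 0 j ^+ 2 = k ^+ 2 by rewrite sqr_enorm; apply: eq_bigr.
by rewrite divff// expf_neq0// gt_eqF.
Qed.

Lemma freqE : (freq R xi)^T = k *: direction.
Proof. by apply/colP => i; rewrite !mxE mulrC divfK// gt_eqF. Qed.

Lemma gradient_symbol_direction : gradient_symbol delta omhd xi = gradient_factor *: direction.
Proof.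
have [[_ _ uo] _ _ _] := KA.
apply/colP => i; rewrite gradient_symbolE; last exact: rescale_supp.
by rewrite (sin_symbolE omhd_weight _ freq_neq0) dotp_delta !mxE.
Qed.

Lemma diffusion_symbol_bounds :
  lam <= k ^+ 2 /\ k ^+ 2 * (1 - (delta * k) ^+ 2 / 12) <= lam.
Proof.
have [[uo _ _] _ _ _] := KA.
rewrite diffusion_symbolE; last exact: rescale_supp.
have W := omd_weight; have Q1 : 2 * d%:R / d%:R / 2 = 1 :> R by field.
have := cos_symbol_le W (freq R xi); have := cos_symbol_ge delta0 W (freq R xi).
by rewrite Q1 !mul1r.
Qed.

Lemma diffusion_symbol_high : 1 <= delta * k -> 2 / 9 / delta ^+ 2 <= lam.
Proof.
have [[uo _ _] _ _ _] := KA.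
rewrite diffusion_symbolE; last exact: rescale_supp.
by move=> x1; have := cos_symbol_ge_high delta0 omd_weight x1; rewrite mulfK.
Qed.

Lemma stabilization_symbol_bounds : [/\ 0 <= c, c <= M * k ^+ 2 &
  1 <= delta * k -> m / 27 / delta ^+ 2 <= c].
Proof.
have [[_ uo _] _ _ _] := KA.
rewrite diffusion_symbolE; last exact: rescale_supp.
have [S /andP[mS SM] W] := omtd_weight.
have S0 : 0 <= S by rewrite (le_trans (ltW m0)).
split.
- apply: Rintegral_ge0 => t _.
  by rewrite mulr_ge0 ?subr_ge0 ?cos_le1// (weight_ge0 W)// enorm_ge0.
- apply: (le_trans (cos_symbol_le W _)); rewrite ler_wpM2r ?sqr_ge0//.
  apply: le_trans SM; rewrite -mulrA -invfM ler_pdivrMr ?mulr_gt0 ?ltr0n//.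
  by rewrite ler_peMr//; move: dge1; lra.
- move=> x1; apply: le_trans (cos_symbol_ge_high delta0 W x1).
  rewrite ler_wpM2r ?invr_ge0 ?sqr_ge0//.
  have -> : S / d%:R / 9 = S / (9 * d%:R) by field.
  rewrite ler_pM ?invr_ge0 ?(ltW m0)// lef_pV2 ?posrE ?mulr_gt0 ?ltr0n//.
  by move: dle3; lra.
Qed.

Lemma gradient_factor_bounds :
  gradient_factor <= k /\ k * (1 - (delta * k) ^+ 2 / 6) <= gradient_factor.
Proof.
have W := omhd_weight; have Q1 : d%:R / d%:R = 1 :> R by rewrite divff.
have := radial_sin_symbol_le W (ltW k0); have := radial_sin_symbol_ge delta0 W (ltW k0).
by rewrite Q1 !mulr1.
Qed.

(** For 0 < r < 1/k the lower bound on omega gives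
    omega_delta(r) >= C1 delta^-(d + 2) x^(d + 2 alpha), which is integrated
    over the box of cos_symbol_ge_box, of volume comparable to k^-d. The
    constant does not depend on alpha. *)
Lemma diffusion_symbol_fractional (C1 alpha : R) : 0 < C1 ->
  (forall r, 0 < r < 1 -> C1 / r `^ (d%:R + 2 * alpha) <= om r) ->
  0 <= alpha -> 1 <= delta * k ->
  C1 / (16 * 33) * ((delta * k) `^ alpha) ^+ 2 / delta ^+ 2 <= lam.
Proof.
move=> C10 hom al0 x1; have [[uo _ _] _ _ _] := KA.
rewrite diffusion_symbolE; last exact: rescale_supp.
have x0 : 0 < delta * k by exact: lt_le_trans x1.
have p0 : 0 <= d%:R + 2 * alpha by rewrite addr_ge0// mulr_ge0.
pose c0 := (delta ^+ (d + 2))^-1 * (C1 * (delta * k) `^ (d%:R + 2 * alpha)).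
have c00 : 0 <= c0.
  by rewrite !mulr_ge0 ?invr_ge0 ?exprn_ge0 ?powR_ge0 ?(ltW delta0) ?(ltW C10).
apply: le_trans (cos_symbol_ge_box omd_weight n1 k0 c00 _); last first.
  move=> r /andP[r0 rk]; rewrite /rescale /c0 ler_wpM2l ?invr_ge0 ?exprn_ge0 ?(ltW delta0)//.
  have rd0 : 0 < r / delta by rewrite divr_gt0.
  have rx : r / delta < (delta * k)^-1.
    by rewrite invfM mulrC ltr_pM2l ?invr_gt0.
  apply: le_trans (hom _ _); last first.
    by rewrite rd0 (lt_le_trans rx)// invf_le1.
  rewrite ler_wpM2l ?(ltW C10)// -[leRHS]mul1r ler_pdivlMr ?powR_gt0//.
  rewrite -powRM ?(ltW x0) ?(ltW rd0)//.
  apply: (@le_trans _ _ (1 `^ (d%:R + 2 * alpha))); last by rewrite powR1.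
  apply: ge0_ler_powR => //; rewrite ?nnegrE//.
    exact: mulr_ge0 (ltW x0) (ltW rd0).
  by rewrite mulrC -ler_pdivlMr// mul1r ltW.
have xE : (delta * k) `^ (d%:R + 2 * alpha) =
    (delta * k) ^+ d * ((delta * k) `^ alpha) ^+ 2.
  rewrite powRD; last by rewrite (gt_eqF x0) implybT.
  by rewrite powR_mulrn ?(ltW x0)// [2 * alpha]mulrC powRrM powR_mulrn ?powR_ge0.
rewrite /c0 xE.
move: ((delta * k) `^ alpha) => y.
have -> : (delta ^+ (d + 2))^-1 * (C1 * ((delta * k) ^+ d * y ^+ 2)) / k ^+ d / 4 / 2 ^+ n.+1 / 33 =
    C1 * y ^+ 2 / delta ^+ 2 / (4 * 2 ^+ n.+1 * 33).
  by rewrite exprD exprMn; field; rewrite !expf_neq0 ?gt_eqF.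
have -> : C1 / (16 * 33) * y ^+ 2 / delta ^+ 2 = C1 * y ^+ 2 / delta ^+ 2 / (16 * 33) by ring.
rewrite ler_wpM2l//.
  by rewrite divr_ge0 ?sqr_ge0// mulr_ge0 ?sqr_ge0// ltW.
have z0 : 0 < 2 ^+ n.+1 :> R by rewrite exprn_gt0.
rewrite lef_pV2 ?posrE; [|by rewrite !mulr_gt0..].
have : 2 ^+ n.+1 <= 4 :> R by rewrite -natrX ler_nat; case: (n) n1 => [|[]].
by move: (2 ^+ n.+1) z0 => z z0 z4; rewrite ler_pM2r//; lra.
Qed.

End kernel_bounds.

(** * Norms as sums over frequencies *)

Section weighted_norms.
Context {R : realType}.
Implicit Types d : nat.

Definition hterm d (s : R) (v : functional R d) (xi : 'rV[int]_d) : R :=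
  enorm (freq R xi) `^ (2 * s) * Normc.normc (fourier v xi) ^+ 2.

Lemma normc_ge0 (z : R[i]) : 0 <= Normc.normc z.
Proof. by case: z => a b; exact: sqrtr_ge0. Qed.

Lemma hterm_ge0 d s (v : functional R d) xi : 0 <= hterm s v xi.
Proof. by rewrite mulr_ge0 ?powR_ge0 ?sqr_ge0. Qed.

Lemma htermE d s (v : functional R d) xi :
  hterm s v xi = (enorm (freq R xi) `^ s * Normc.normc (fourier v xi)) ^+ 2.
Proof. by rewrite /hterm exprMn [2 * s]mulrC powRrM powR_mulrn ?powR_ge0. Qed.

Local Notation frequencies d := [set xi : 'rV[int]_d | xi != 0].

Definition freq_sum d (X : 'rV[int]_d -> R) : \bar R :=
  (((2 * pi) ^- d)%:E * \esum_(xi in frequencies d) (X xi)%:E)%E.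

Lemma pi_factor_ge0 d : 0 <= (2 * pi : R) ^- d.
Proof. by rewrite invr_ge0 exprn_ge0// mulr_ge0// pi_ge0. Qed.

Lemma freq_sum_ge0 d (X : 'rV[int]_d -> R) : (forall xi, 0 <= X xi) ->
  (0 <= freq_sum X)%E.
Proof.
move=> X0; rewrite mule_ge0 ?lee_fin ?pi_factor_ge0//.
by apply: esum_ge0 => xi _; rewrite lee_fin.
Qed.

Lemma Hnorm_sqE d s (v : functional R d) : Hnorm_sq s v = freq_sum (hterm s v).
Proof. by []. Qed.

Lemma sum_Hnorm_sqE d s (v : 'I_d -> functional R d) :
  (\sum_(i < d) Hnorm_sq s (v i))%E =
  freq_sum (fun xi => \sum_(i < d) hterm s (v i) xi).
Proof.
rewrite /freq_sum -ge0_sume_distrr; last first.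
  by move=> i _; apply: esum_ge0 => xi _; rewrite lee_fin hterm_ge0.
congr (_ * _)%E.
rewrite -(esum_sum _ _ (a := fun xi i => (hterm s (v i) xi)%:E)).
  by apply: eq_esum => xi _; rewrite sumEFin.
by move=> xi i _ _; rewrite lee_fin hterm_ge0.
Qed.

Lemma esumZ_le (T : choiceType) (I : set T) (a : T -> \bar R) (c : R) : 0 <= c ->
  (forall t, 0 <= a t)%E ->
  (\esum_(t in I) (c%:E * a t) <= c%:E * \esum_(t in I) a t)%E.
Proof.
move=> c0 a0; apply: ub_ereal_sup => _ [A [fA AI] <-].
rewrite -ge0_mule_fsumr//; apply: lee_wpmul2l; first by rewrite lee_fin.
by apply: ereal_sup_ubound; exists A.
Qed.

(** Passing from squared norms to norms: the square root is subadditive. Infinite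
    values of y and z are data norms that are not finite. *)
Lemma sqrte_lin_le (C a b : R) (x y z : \bar R) : 0 <= C -> 0 <= a -> 0 <= b ->
  (0 <= x)%E -> (0 <= y)%E -> (0 <= z)%E ->
  (x <= (C ^+ 2)%:E * ((a ^+ 2)%:E * y + (b ^+ 2)%:E * z))%E ->
  (x `^ 2^-1 <= C%:E * (a%:E * y `^ 2^-1 + b%:E * z `^ 2^-1))%E.
Proof.
move=> C0 a0 b0 x0 y0 z0 xyz.
have sq (u : R) : 0 <= u -> ((u ^+ 2)%:E `^ 2^-1 = u%:E)%E.
  by move=> u0; rewrite poweR_EFin powR12_sqrt ?sqr_ge0// sqrtr_sqr ger0_norm.
have sqM (u : R) w : 0 <= u -> (0 <= w)%E ->
    (((u ^+ 2)%:E * w) `^ 2^-1 = u%:E * w `^ 2^-1)%E.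
  by move=> u0 w0; rewrite poweRM ?lee_fin ?sqr_ge0// sq.
have mono (u w : \bar R) : (0 <= u)%E -> (u <= w)%E -> (u `^ 2^-1 <= w `^ 2^-1)%E.
  move=> u0 uw; apply: gt0_ler_poweR => //.
  - by rewrite in_itv/= u0 leey.
  - by rewrite in_itv/= (le_trans u0 uw) leey.
have sub (u w : \bar R) : (0 <= u)%E -> (0 <= w)%E ->
    ((u + w) `^ 2^-1 <= u `^ 2^-1 + w `^ 2^-1)%E.
  have i2 : (2^-1 : R) != 0 by rewrite invr_eq0.
  case: u => [u|_ _|//]; last first.
    rewrite [leRHS](_ : _ = +oo%E) ?leey// poweRyr// addye//.
    by rewrite gt_eqF// (lt_le_trans (ltNyr 0)) ?poweR_ge0.
  case: w => [w|_ _|_ //]; last first.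
    by rewrite [leRHS](_ : _ = +oo%E) ?leey// [X in (_ + X)%E]poweRyr// addey.
  rewrite !lee_fin => u0 w0.
  change ((u + w)%:E `^ 2^-1 <= u%:E `^ 2^-1 + w%:E `^ 2^-1)%E.
  rewrite !poweR_EFin; change ((u + w) `^ 2^-1 <= u `^ 2^-1 + w `^ 2^-1).
  rewrite !powR12_sqrt ?addr_ge0//.
  rewrite -ler_sqr ?nnegrE ?addr_ge0 ?sqrtr_ge0// sqr_sqrtr ?addr_ge0//.
  by rewrite sqrrD !sqr_sqrtr// lerD2r lerDl mulrn_wge0// mulr_ge0 ?sqrtr_ge0.
apply: (le_trans (mono _ _ x0 xyz)).
have a2 : (0 <= (a ^+ 2)%:E * y)%E by rewrite mule_ge0// lee_fin sqr_ge0.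
have b2 : (0 <= (b ^+ 2)%:E * z)%E by rewrite mule_ge0// lee_fin sqr_ge0.
rewrite sqM ?adde_ge0//; apply: lee_wpmul2l; first by rewrite lee_fin.
by apply: (le_trans (sub _ _ a2 b2)); rewrite !sqM.
Qed.

Lemma freq_sum_sqrt_le d (X Y Z : 'rV[int]_d -> R) (C a b : R) :
  0 <= C -> 0 <= a -> 0 <= b ->
  (forall xi, 0 <= X xi) -> (forall xi, 0 <= Y xi) -> (forall xi, 0 <= Z xi) ->
  (forall xi, xi != 0 -> X xi <= C ^+ 2 * (a ^+ 2 * Y xi + b ^+ 2 * Z xi)) ->
  (freq_sum X `^ 2^-1 <=
   C%:E * (a%:E * freq_sum Y `^ 2^-1 + b%:E * freq_sum Z `^ 2^-1))%E.
Proof.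
move=> C0 a0 b0 X0 Y0 Z0 XYZ; apply: sqrte_lin_le => //; try exact: freq_sum_ge0.
have scale (c : R) (V : 'rV[int]_d -> R) : 0 <= c -> (forall xi, 0 <= V xi) ->
    (freq_sum (fun xi => (c * V xi)%R) <= c%:E * freq_sum V)%E.
  move=> c0 V0; rewrite /freq_sum muleCA; apply: lee_wpmul2l.
    by rewrite lee_fin pi_factor_ge0.
  by apply: (@esumZ_le _ _ (fun xi => (V xi)%:E) c c0) => t; rewrite lee_fin.
apply: (@le_trans _ _ (freq_sum (fun xi => C ^+ 2 * (a ^+ 2 * Y xi + b ^+ 2 * Z xi)))).
  apply: lee_wpmul2l; first by rewrite lee_fin pi_factor_ge0.
  by apply: le_esum => xi xi0; rewrite lee_fin XYZ.
have aY xi : 0 <= a ^+ 2 * Y xi by rewrite mulr_ge0 ?sqr_ge0.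
have bZ xi : 0 <= b ^+ 2 * Z xi by rewrite mulr_ge0 ?sqr_ge0.
apply: (le_trans (scale _ _ (sqr_ge0 C) _)); first by move=> xi; rewrite addr_ge0.
apply: lee_wpmul2l; first by rewrite lee_fin sqr_ge0.
apply: (@le_trans _ _ (freq_sum (fun xi => (a ^+ 2 * Y xi)%R) + freq_sum (fun xi => (b ^+ 2 * Z xi)%R))%E).
  rewrite /freq_sum -ge0_muleDr; last 2 first.
  - by apply: esum_ge0 => xi _; rewrite lee_fin.
  - by apply: esum_ge0 => xi _; rewrite lee_fin.
  rewrite -esumD; [|by move=> xi _; rewrite lee_fin..].
  by [].
by apply: leeD; apply: scale => //; exact: sqr_ge0.
Qed.

End weighted_norms.

Section frequency_estimate.
Context {R : realType} {n : nat}.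
Local Notation d := n.+2.
Local Open Scope complex_scope.
Implicit Types z : R[i].
Local Notation normc := (@Normc.normc R).

Lemma normcR (a : R) : normc a%:C = `|a|.
Proof. by rewrite /= expr0n addr0 sqrtr_sqr. Qed.

Lemma normc_i : normc 'i%C = 1.
Proof. by rewrite /= expr0n add0r expr1n sqrtr1. Qed.

Lemma normcB z1 z2 : normc (z1 - z2) <= normc z1 + normc z2.
Proof. by apply: (le_trans (le_normcD _ _)); rewrite normcN. Qed.

Lemma normc_sum I (r : seq I) (F : I -> R[i]) :
  normc (\sum_(i <- r) F i) <= \sum_(i <- r) normc (F i).
Proof.
elim: r => [|i r IH]; first by rewrite !big_nil normcR normr0.
by rewrite !big_cons (le_trans (le_normcD _ _))// lerD2l.
Qed.

Lemma sqr_sum_le (v : 'I_d -> R) : (\sum_i v i) ^+ 2 <= d%:R * \sum_i v i ^+ 2.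
Proof.
have := sqr_dotp_le (\row_i v i) (const_mx 1).
rewrite !sqr_enorm /dotp [X in _ * X](_ : _ = d%:R); last first.
  under eq_bigr do rewrite mxE mulr1.
  by rewrite sumr_const card_ord.
rewrite mulrC; under eq_bigr do rewrite !mxE mulr1.
by under [X in _ <= _ * X]eq_bigr do rewrite !mxE -expr2.
Qed.

Lemma fourierB (u v : functional R d) xi :
  fourier (u \- v)%R xi = fourier u xi - fourier v xi.
Proof. by rewrite /fourier /=; ring. Qed.

Lemma velocity_error_le (e : 'cV[R]_d) (F : 'cV[R[i]]_d) G Fpar N (a1 a2 a3 : R) j :
  `|e j 0| <= 1 -> normc (F j 0) <= N -> normc Fpar <= N ->
  normc (a1%:C * (F j 0 - (e j 0)%:C * Fpar) -
         (e j 0)%:C * (a3%:C * Fpar + 'i%C * a2%:C * G)) <=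
  (2 * `|a1| + `|a3|) * N + `|a2| * normc G.
Proof.
move=> e1 FN PN; have N0 : 0 <= N by apply: le_trans PN; exact: normc_ge0.
apply: (le_trans (normcB _ _)); rewrite !Normc.normcM !normcR.
have -> : (2 * `|a1| + `|a3|) * N + `|a2| * normc G =
   `|a1| * (N + N) + (`|a3| * N + `|a2| * normc G) by ring.
have eP z : `|e j 0| * normc z <= normc z.
  by rewrite ler_piMl ?normc_ge0.
apply: lerD.
  rewrite ler_wpM2l//; apply: (le_trans (normcB _ _)); rewrite lerD//.
  by rewrite Normc.normcM normcR (le_trans (eP _)).
apply: (le_trans (eP _)); apply: (le_trans (le_normcD _ _)).
rewrite !Normc.normcM !normcR normc_i mul1r lerD//.
by rewrite ler_wpM2l.
Qed.

End frequency_estimate.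

(** * The error estimate for a coercive diffusion symbol *)

Section error_estimate.
Context {R : realType} {n : nat}.
Local Notation d := n.+2.
Variables (m M delta alpha K : R) (om omt omh : R -> R).
Hypotheses (n1 : (n <= 1)%N) (delta01 : 0 < delta < 1).
Hypothesis (KA : kernel_assumption d m M delta om omt omh).
Hypotheses (m0 : 0 < m) (mM : m < M) (alpha01 : 0 <= alpha <= 1) (K0 : 0 < K).
Variables (f u ud : 'I_d -> functional R d) (g p pd : functional R d).
Hypothesis (nonlocal : nonlocal_solution delta om omt omh f g ud pd).
Hypothesis (stokes : stokes_solution f g u p).
Local Notation k xi := (enorm (freq R xi)).
Local Notation lam xi := (diffusion_symbol delta (rescale (d + 2) delta om) xi).
Local Notation c xi := (diffusion_symbol delta (rescale (d + 2) delta omt) xi).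
Local Notation beta_ xi := (gradient_factor delta omh xi).
Local Notation D xi := (lam xi * (delta ^+ 2 * c xi) + beta_ xi ^+ 2).
Hypothesis coercive : forall xi : 'rV[int]_d, xi != 0 -> 1 <= delta * k xi ->
  K * ((delta * k xi) `^ alpha) ^+ 2 / delta ^+ 2 <= lam xi.
Variables (eta beta : R).
Hypotheses (eta01 : 0 <= eta <= 1) (beta02 : 0 <= beta <= 2).
Local Notation C0 := (symbol_const m M K).

Let M0 : 0 < M. Proof. exact: lt_trans mM. Qed.
Let delta0 : 0 < delta. Proof. by case/andP: delta01. Qed.

Lemma symbol_const_gt0 : 0 < C0.
Proof.
have [_ _ C1 _] := symbol_const_ge m0 M0 K0.
by apply: lt_le_trans C1; rewrite ltr_pwDl// divr_ge0// ltW.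
Qed.

Section frequency.
Variable xi : 'rV[int]_d.
Hypothesis xi0 : xi != 0.

Let k1 : 1 <= k xi. Proof. exact: enorm_freq_ge1. Qed.
Let k0 : 0 < k xi. Proof. exact: lt_le_trans k1. Qed.
Local Notation A1 := (k xi ^- 2 - (lam xi)^-1).
Local Notation A2 := ((k xi)^-1 - beta_ xi / D xi).
Local Notation A3 := (delta ^+ 2 * c xi / D xi).
Local Notation A4 := (1 - lam xi / D xi).
Local Notation af := (delta `^ Num.min 2 (2 - 2 * alpha + eta)).
Local Notation ag := (delta `^ Num.min 2 (1 - alpha + beta)).
Local Notation bf := (delta `^ (1 - alpha + eta)).
Local Notation bg := (delta `^ beta).

Lemma weighted_symbol_errors :
  [/\ lam xi != 0 /\ D xi != 0,
      k xi `^ alpha * `|A1| <= C0 * (af * k xi `^ (eta - alpha)),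
      k xi `^ alpha * `|A3| <= C0 * (af * k xi `^ (eta - alpha)),
      k xi `^ alpha * `|A2| <= C0 * (ag * k xi `^ beta) &
      `|A2| <= C0 * (bf * k xi `^ (eta - alpha)) /\
      `|A4| <= C0 * (bg * k xi `^ beta)].
Proof.
have [lam_le lam_ge] := diffusion_symbol_bounds delta01 KA xi.
have [b_le b_ge] := gradient_factor_bounds delta01 KA xi0.
have [c0 c_le c_ge] := stabilization_symbol_bounds n1 delta01 KA m0 xi.
have C00 := ltW symbol_const_gt0.
have step (s a w z t : R) : 0 <= s -> a <= C0 * w -> s * w <= z * t ->
    s * a <= C0 * (z * t).
  move=> s0 aw sw; apply: (@le_trans _ _ (C0 * (s * w))).
    by rewrite mulrCA ler_wpM2l.
  by rewrite ler_wpM2l.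
have step1 (a w z t : R) : a <= C0 * w -> w <= z * t -> a <= C0 * (z * t).
  by move=> aw wz; rewrite (le_trans aw)// ler_wpM2l.
have ka : 0 <= k xi `^ alpha by exact: powR_ge0.
have [x1|/ltW x1] := leP (delta * k xi) 1.
  have [[l0 D0] E1 E3 E2 E4] :=
    symbol_error_low m0 M0 K0 delta0 k0 lam_le lam_ge c0 c_le b_le b_ge x1.
  have [P1 P2 P3 P4] := power_weights_low delta01 k1 alpha01 eta01 beta02 x1.
  split; [by rewrite !gt_eqF| | | |split].
  - exact: step E1 P1.
  - exact: step E3 P1.
  - exact: step E2 P2.
  - exact: step1 E2 P3.
  - exact: step1 E4 P4.
have y1 := power_weight_y alpha01 x1.
have [[l0 D0] E1 E3 E2 E4] :=
  symbol_error_high m0 M0 K0 (beta_ xi) delta0 k0 c0 y1 (c_ge x1) (coercive xi0 x1).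
have [P1 P2 P3 P4] := power_weights_high delta01 k1 alpha01 eta01 beta02 x1.
split; [by rewrite !gt_eqF| | | |split].
- exact: step E1 P1.
- exact: step E3 P1.
- exact: step E2 P2.
- exact: step1 E2 P3.
- by apply: (step1 _ 1) P4; rewrite mulr1.
Qed.

Local Notation F := (fourierv f xi).
Local Notation G := (fourier g xi).
Local Notation e := (direction (R := R) xi).
Local Notation Fpar := (\sum_j (e j 0)%:C%C * F j 0).
Local Notation normc := (@Normc.normc R).

(** The difference of the two instances of saddle_solution; for the Stokes
    system a = k^2, beta = k and c = 0, so that D = k^2. *)
Lemma fourier_errors :
  fourier p xi - fourier pd xi = A4%:C%C * G - 'i%C * A2%:C%C * Fpar /\
  forall j, fourier (u j) xi - fourier (ud j) xi =
    A1%:C%C * (F j 0 - (e j 0)%:C%C * Fpar) -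
    (e j 0)%:C%C * (A3%:C%C * Fpar + 'i%C * A2%:C%C * G).
Proof.
have [[l0 D0] _ _ _ _] := weighted_symbol_errors.
have e1 := direction_unit (R := R) xi0.
have kn : k xi != 0 by rewrite gt_eqF.
have := nonlocal xi0; rewrite (gradient_symbol_direction delta01 KA xi0).
move=> /(saddle_solution e1 l0 D0)[Pd Ud].
have := stokes xi0; rewrite (freqE xi0).
have Dk : k xi ^+ 2 * 0 + k xi ^+ 2 = k xi ^+ 2 by rewrite mulr0 add0r.
have Dk0 : k xi ^+ 2 * 0 + k xi ^+ 2 != 0 by rewrite Dk expf_neq0.
move=> /(saddle_solution e1 (expf_neq0 2 kn) Dk0); rewrite Dk => -[P U].
have kk : k xi / k xi ^+ 2 = (k xi)^-1 by field.
split.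
  rewrite P Pd divff ?expf_neq0// kk !rmorphB/= rmorph1; ring.
move=> j; have := U j; have := Ud j; rewrite !mxE => -> ->.
by rewrite kk mul0r !rmorphB/= rmorph0; ring.
Qed.

Let NF := \sum_j normc (F j 0).

Lemma direction_le1 j : `|e j 0| <= 1.
Proof.
rewrite -(@ler_sqr _ `|_| 1) ?nnegrE// expr1n real_normK ?num_real//.
rewrite -(direction_unit (R := R) xi0) (bigD1 j)//= lerDl.
by apply: sumr_ge0 => i _; exact: sqr_ge0.
Qed.

Let F_le j : normc (F j 0) <= NF.
Proof. by rewrite /NF (bigD1 j)//= lerDl; apply: sumr_ge0 => i _; exact: normc_ge0. Qed.

Let Fpar_le : normc Fpar <= NF.
Proof.
apply: (le_trans (normc_sum _ _)); apply: ler_sum => i _.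
by rewrite Normc.normcM normcR ler_piMl ?normc_ge0 ?direction_le1.
Qed.

Let NF0 : 0 <= NF. Proof. exact: le_trans (normc_ge0 _) Fpar_le. Qed.

Let d3 : d%:R <= 3 :> R. Proof. by rewrite ler_nat; case: (n) n1 => [|[]]. Qed.

Let NF2 s : (k xi `^ s * NF) ^+ 2 <= 3 * \sum_j hterm s (f j) xi.
Proof.
rewrite exprMn; under eq_bigr do rewrite htermE exprMn.
rewrite -mulr_sumr [leRHS]mulrCA ler_wpM2l ?sqr_ge0//.
apply: (le_trans (sqr_sum_le _)).
under [X in _ * X <= _]eq_bigr do rewrite mxE.
by rewrite ler_wpM2r//; apply: sumr_ge0 => i _; exact: sqr_ge0.
Qed.

Lemma sqrD_le2 (a b : R) : (a + b) ^+ 2 <= 2 * a ^+ 2 + 2 * b ^+ 2.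
Proof. by have := sqr_ge0 (a - b); nra. Qed.

(** Bounding |f_e| and each |f_j| by the sum N of the |f_j| gives at most
    C0 (3 z + t) for each component, with z and t the weighted sizes of f and g.
    As d <= 3 and N^2 <= 3 sum |f_j|^2, the square of 13 >= sqrt 162 absorbs all
    numerical factors. *)
Lemma velocity_frequency_error :
  \sum_j hterm alpha (u j \- ud j)%R xi <= (13 * C0) ^+ 2 *
    (af ^+ 2 * (\sum_j hterm (eta - alpha) (f j) xi) + ag ^+ 2 * hterm beta g xi).
Proof.
have [_ E1 E3 E2 _] := weighted_symbol_errors.
have [_ EU] := fourier_errors.
have C00 := ltW symbol_const_gt0.
have ka : 0 <= k xi `^ alpha by exact: powR_ge0.
pose z := af * k xi `^ (eta - alpha) * NF; pose t := ag * k xi `^ beta * normc G.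
have z0 : 0 <= z by rewrite !mulr_ge0 ?powR_ge0.
have t0 : 0 <= t by rewrite !mulr_ge0 ?powR_ge0 ?normc_ge0.
have Ej j : hterm alpha (u j \- ud j)%R xi <= (C0 * (3 * z + t)) ^+ 2.
  rewrite htermE fourierB EU lerXn2r ?nnegrE//.
  - by rewrite mulr_ge0 ?normc_ge0.
  - by rewrite mulr_ge0// addr_ge0// mulr_ge0.
  apply: (@le_trans _ _ (k xi `^ alpha *
     ((2 * `|A1| + `|A3|) * NF + `|A2| * normc G))).
    by rewrite ler_wpM2l//; apply: velocity_error_le => //; exact: direction_le1.
  have h1 := ler_wpM2r NF0 E1; have h3 := ler_wpM2r NF0 E3.
  have h2 := ler_wpM2r (normc_ge0 G) E2.
  have -> : k xi `^ alpha * ((2 * `|A1| + `|A3|) * NF + `|A2| * normc G) =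
    2 * (k xi `^ alpha * `|A1| * NF) + k xi `^ alpha * `|A3| * NF
      + k xi `^ alpha * `|A2| * normc G by ring.
  have -> : C0 * (3 * z + t) = 2 * (C0 * (af * k xi `^ (eta - alpha)) * NF)
     + C0 * (af * k xi `^ (eta - alpha)) * NF + C0 * (ag * k xi `^ beta) * normc G.
    by rewrite /z /t; ring.
  by rewrite !lerD// ler_wpM2l.
have zle : z ^+ 2 <= af ^+ 2 * (3 * \sum_j hterm (eta - alpha) (f j) xi).
  by rewrite /z -mulrA exprMn ler_wpM2l ?sqr_ge0.
have tE : t ^+ 2 = ag ^+ 2 * hterm beta g xi by rewrite /t htermE -mulrA exprMn.
apply: (@le_trans _ _ (\sum_(j < d) (C0 * (3 * z + t)) ^+ 2)); first exact: ler_sum.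
rewrite sumr_const card_ord -[leLHS]mulr_natl exprMn [leRHS](_ : _ = C0 ^+ 2 *
  (169 * (af ^+ 2 * (\sum_j hterm (eta - alpha) (f j) xi) + ag ^+ 2 * hterm beta g xi))); last by ring.
rewrite mulrCA ler_wpM2l ?sqr_ge0//.
apply: (@le_trans _ _ (3 * (3 * z + t) ^+ 2)); first by rewrite ler_wpM2r ?sqr_ge0.
have := sqrD_le2 (3 * z) t; rewrite tE exprMn.
have : 0 <= ag ^+ 2 * hterm beta g xi by rewrite -tE sqr_ge0.
move: (sqr_ge0 z) zle; rewrite mulrCA.
move: (z ^+ 2) (af ^+ 2 * _) (ag ^+ 2 * _) ((3 * z + t) ^+ 2) => q r v w; lra.
Qed.

Lemma pressure_frequency_error :
  hterm 0 (p \- pd)%R xi <= (13 * C0) ^+ 2 *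
    (bf ^+ 2 * (\sum_j hterm (eta - alpha) (f j) xi) + bg ^+ 2 * hterm beta g xi).
Proof.
have [_ _ _ _ [E2 E4]] := weighted_symbol_errors.
have [EP _] := fourier_errors.
have C00 := ltW symbol_const_gt0.
pose z := bf * k xi `^ (eta - alpha) * NF; pose t := bg * k xi `^ beta * normc G.
have z0 : 0 <= z by rewrite !mulr_ge0 ?powR_ge0.
have t0 : 0 <= t by rewrite !mulr_ge0 ?powR_ge0 ?normc_ge0.
have Ep : hterm 0 (p \- pd)%R xi <= (C0 * (z + t)) ^+ 2.
  rewrite htermE fourierB EP powRr0 mul1r lerXn2r ?nnegrE ?normc_ge0//.
    by rewrite mulr_ge0// addr_ge0.
  apply: (le_trans (normcB _ _)); rewrite !Normc.normcM !normcR normc_i mul1r.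
  have h4 := ler_wpM2r (normc_ge0 G) E4.
  have h2 : `|A2| * normc Fpar <= C0 * (bf * k xi `^ (eta - alpha)) * NF.
    by apply: ler_pM => //; exact: normc_ge0.
  have -> : C0 * (z + t) = C0 * (bg * k xi `^ beta) * normc G
     + C0 * (bf * k xi `^ (eta - alpha)) * NF by rewrite /z /t; ring.
  exact: lerD.
have zle : z ^+ 2 <= bf ^+ 2 * (3 * \sum_j hterm (eta - alpha) (f j) xi).
  by rewrite /z -mulrA exprMn ler_wpM2l ?sqr_ge0.
have tE : t ^+ 2 = bg ^+ 2 * hterm beta g xi by rewrite /t htermE -mulrA exprMn.
apply: (le_trans Ep); rewrite exprMn [leRHS](_ : _ = C0 ^+ 2 *
  (169 * (bf ^+ 2 * (\sum_j hterm (eta - alpha) (f j) xi) + bg ^+ 2 * hterm beta g xi))); last by ring.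
rewrite ler_wpM2l ?sqr_ge0//.
have := sqrD_le2 z t; rewrite tE.
have : 0 <= bg ^+ 2 * hterm beta g xi by rewrite -tE sqr_ge0.
move: (sqr_ge0 z) zle; rewrite mulrCA.
move: (z ^+ 2) (bf ^+ 2 * _) (bg ^+ 2 * _) ((z + t) ^+ 2) => q r v w; lra.
Qed.

End frequency.

Lemma nonlocal_stokes_error :
  (Hnormv alpha (fun i => (u i \- ud i)%R) <=
    (13 * C0)%:E * ((delta `^ Num.min 2 (2 - 2 * alpha + eta))%:E
                      * Hnormv (eta - alpha) f +
                    (delta `^ Num.min 2 (1 - alpha + beta))%:E * Hnorm beta g))%E /\
  (L2norm (p \- pd)%R <=
    (13 * C0)%:E * ((delta `^ (1 - alpha + eta))%:E * Hnormv (eta - alpha) f +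
                    (delta `^ beta)%:E * Hnorm beta g))%E.
Proof.
have C00 : 0 <= 13 * C0 by rewrite mulr_ge0// ltW// symbol_const_gt0.
have sum_ge0 s (v : 'I_d -> functional R d) xi : 0 <= \sum_j hterm s (v j) xi.
  by apply: sumr_ge0 => j _; exact: hterm_ge0.
split.
  rewrite /Hnormv !sum_Hnorm_sqE /Hnorm Hnorm_sqE.
  apply: freq_sum_sqrt_le => //; rewrite ?powR_ge0//; first exact: hterm_ge0.
  exact: velocity_frequency_error.
rewrite /L2norm /Hnormv !sum_Hnorm_sqE /Hnorm !Hnorm_sqE.
apply: freq_sum_sqrt_le => //; rewrite ?powR_ge0//; try exact: hterm_ge0.
exact: pressure_frequency_error.
Qed.

End error_estimate.

(** * The theorem *)

Theorem theorem4p1 (R : realType) (m M : R) (m_gt0 : 0 < m) (ltmM : m < M) :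
  (exists C : R, 0 < C /\
    forall (d : nat) (delta : R) (om omt omh : R -> R)
      (f : 'I_d -> functional R d) (g : functional R d)
      (ud : 'I_d -> functional R d) (pd : functional R d)
      (u : 'I_d -> functional R d) (p : functional R d),
    stokes_setting m M delta om omt omh f g ud pd u p ->
    forall eta beta : R, 0 <= eta <= 1 -> 0 <= beta <= 2 ->
      (L2normv (fun i => (u i \- ud i)%R) <=
        C%:E * ((delta ^+ 2)%:E * L2normv f +
                (delta `^ Num.min 2 (1 + beta))%:E * Hnorm beta g))%E /\
      (L2norm (p \- pd)%R <=
        C%:E * ((delta `^ (1 + eta))%:E * Hnormv eta f +
                (delta `^ beta)%:E * Hnorm beta g))%E) /\
  (forall C1 : R, 0 < C1 ->
   exists C : R, 0 < C /\
    forall (d : nat) (delta : R) (om omt omh : R -> R)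
      (f : 'I_d -> functional R d) (g : functional R d)
      (ud : 'I_d -> functional R d) (pd : functional R d)
      (u : 'I_d -> functional R d) (p : functional R d) (alpha C2 : R),
    stokes_setting m M delta om omt omh f g ud pd u p ->
    0 < alpha < 1 -> 0 < C2 ->
    (forall r : R, 0 < r < 1 ->
       C1 / r `^ (d%:R + 2 * alpha) <= om r <= C2 / r `^ (d%:R + 2 * alpha)) ->
    forall eta beta : R, 0 <= eta <= 1 -> 0 <= beta <= 2 ->
      (Hnormv alpha (fun i => (u i \- ud i)%R) <=
        C%:E * ((delta `^ Num.min 2 (2 - 2 * alpha + eta))%:E
                  * Hnormv (eta - alpha) f +
                (delta `^ Num.min 2 (1 - alpha + beta))%:E * Hnorm beta g))%E /\
      (L2norm (p \- pd)%R <=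
        C%:E * ((delta `^ (1 - alpha + eta))%:E * Hnormv (eta - alpha) f +
                (delta `^ beta)%:E * Hnorm beta g))%E).
Proof.
split.
  have K0 : 0 < 2 / 9 :> R by rewrite divr_gt0.
  exists (13 * symbol_const m M (2 / 9)); split.
    by rewrite mulr_gt0// symbol_const_gt0.
  move=> d delta om omt omh f g ud pd u p [dE d01 KA _ _ _ _ NL _ _ ST] eta beta eta01 beta02.
  have [n n1 dn] : exists2 n, (n <= 1)%N & d = n.+2.
    by case: dE => ->; [exists 0%N|exists 1%N].
  subst d.
  have al0 : 0 <= (0 : R) <= 1 by rewrite lexx ler01.
  have coer (xi : 'rV[int]_n.+2) : xi != 0 -> 1 <= delta * enorm (freq R xi) ->
      2 / 9 * ((delta * enorm (freq R xi)) `^ 0) ^+ 2 / delta ^+ 2 <=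
      diffusion_symbol delta (rescale (n.+2 + 2) delta om) xi.
    move=> _ x1; rewrite powRr0 expr1n mulr1.
    exact: (diffusion_symbol_high d01 KA x1).
  split.
    have [+ _] := nonlocal_stokes_error n1 d01 KA m_gt0 ltmM al0 K0 NL ST coer al0 beta02.
    by rewrite mulr0 !subr0 addr0 minxx (powR_mulrn 2 (ltW _))//; case/andP: d01.
  have [_] := nonlocal_stokes_error n1 d01 KA m_gt0 ltmM al0 K0 NL ST coer eta01 beta02.
  by rewrite !subr0.
move=> C1 C10.
have K0 : 0 < C1 / (16 * 33) by rewrite divr_gt0.
exists (13 * symbol_const m M (C1 / (16 * 33))); split.
  by rewrite mulr_gt0// symbol_const_gt0.
move=> d delta om omt omh f g ud pd u p alpha C2
  [dE d01 KA _ _ _ _ NL _ _ ST] /andP[al0 al1] _ homE eta beta eta01 beta02.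
have [n n1 dn] : exists2 n, (n <= 1)%N & d = n.+2.
  by case: dE => ->; [exists 0%N|exists 1%N].
subst d.
have al01 : 0 <= alpha <= 1 by rewrite !ltW.
apply: (nonlocal_stokes_error n1 d01 KA) => // xi xi0 x1.
apply: (diffusion_symbol_fractional n1 d01 KA) => //; last exact: ltW.
by move=> r /homE /andP[].
Qed.
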